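(* Let $\mathcal H$ be a Hilbert space of finite dimension $d$, let $\{|\psi_x\rangle\}_{x\in\mathsf X}$ be an arbitrary set of unit vectors in $\mathcal H$, and let $n\ge1$ and $1\le k\le m$. Let $\mathscr C_{n,m}$ be a quantum operation from $\mathcal H^{\otimes n}$ to $\mathcal H^{\otimes m}$ with permutationally invariant output. Then there exists a probabilistic-metrology (PM) protocol $\widetilde{\mathscr C}_{n,m}$ from $\mathcal H^{\otimes n}$ to $\mathcal H^{\otimes m}$ such that, for every $x\in\mathsf X$, $$\mathrm{tr}[\widetilde{\mathscr C}_{n,m}(\psi_x^{\otimes n})]=\mathrm{tr}[\mathscr C_{n,m}(\psi_x^{\otimes n})]=:P_{\rm succ}(\psi_x^{\otimes n}),$$ and, whenever $P_{\rm succ}(\psi_x^{\otimes n})>0$, $$\left|F_{k,x}[\mathscr C_{n,m}]-F_{k,x}[\widetilde{\mathscr C}_{n,m}]\right|\le\frac{2kd^2}{m\,P_{\rm succ}(\psi_x^{\otimes n})} .$$ Moreover, if the input state $|\psi_x\rangle^{\otimes n}$ is given with prior probability $p_x$ and the average success probability $P_{\rm succ}=\sum_xp_x\,\mathrm{tr}[\mathscr C_{n,m}(\psi_x^{\otimes n})]$ is positive, then the average $k$-copy fidelities satisfy $$\left|F_k[\mathscr C_{n,m}]-F_k[\widetilde{\mathscr C}_{n,m}]\right|\le\frac{2kd^2}{m\,P_{\rm succ}} .$$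
   Context: $\psi_x:=|\psi_x\rangle\langle\psi_x|$. A quantum operation is a completely positive, trace non-increasing linear map. The output of $\mathscr C_{n,m}$ is permutationally invariant if $\mathscr U_\pi\circ\mathscr C_{n,m}=\mathscr C_{n,m}$ for every permutation $\pi$ of $\{1,\dots,m\}$, where $\mathscr U_\pi(\rho_1\otimes\cdots\otimes\rho_m)=\rho_{\pi(1)}\otimes\cdots\otimes\rho_{\pi(m)}$. A PM protocol is a probabilistic measure-and-prepare operation: a quantum operation of the form $\rho\mapsto\int\mathrm{tr}[M(dy)\rho]\,\sigma_y$, where $M$ is a positive-operator-valued measure on some outcome space with total mass $\int M(dy)\le I$ and $\sigma_y$ are states on $\mathcal H^{\otimes m}$. The $k$-copy fidelity on input $x$ of a quantum operation $\mathscr C$ from $\mathcal H^{\otimes n}$ to $\mathcal H^{\otimes m}$ is $F_{k,x}[\mathscr C]=O_{k,x}[\mathscr C]/P_x[\mathscr C]$, with $O_{k,x}[\mathscr C]=\langle\psi_x|^{\otimes k}\,\mathrm{tr}_{m-k}[\mathscr C(\psi_x^{\otimes n})]\,|\psi_x\rangle^{\otimes k}$ and $P_x[\mathscr C]=\mathrm{tr}[\mathscr C(\psi_x^{\otimes n})]$, where $\mathrm{tr}_{m-k}$ is the partial trace over $m-k$ of the output systems. For a prior $(p_x)$, the average $k$-copy fidelity is $F_k[\mathscr C]=\big(\sum_xp_xO_{k,x}[\mathscr C]\big)/\big(\sum_xp_xP_x[\mathscr C]\big)$. *)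

(* Defs.v *)
From HB Require Import structures.
From mathcomp Require Import all_boot all_order all_algebra fingroup perm.
From mathcomp Require Import all_classical all_reals all_analysis.
From mathcomp Require Import complex.
Set Implicit Arguments.
Unset Strict Implicit.
Unset Printing Implicit Defensive.
Import Order.TTheory GRing.Theory Num.Theory.
Import numFieldNormedType.Exports.
Local Open Scope classical_set_scope.
Local Open Scope ring_scope.
Local Open Scope sesquilinear_scope.

(* The Hilbert space is C^d with C = R[i].  The computational basis of its n-th
   tensor power is indexed by the words {ffun 'I_n -> 'I_d}; vectors and
   operators on the tensor power are matrices whose indices are read as words
   through enum_val / enum_rank. *)
Notation tdim d n := #|{: {ffun 'I_n -> 'I_d}}|.

Definition word d n (i : 'I_(tdim d n)) : {ffun 'I_n -> 'I_d} := enum_val i.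

Section Operators.
Variable R : realType.
Local Notation C := R[i].

(* In R[i], 0 <= z says that z is real and nonnegative, so that psdmx A forces
   A to be Hermitian. *)
Definition psdmx N (A : 'M[C]_N) : Prop :=
  forall v : 'cV[C]_N, 0 <= (v^t* *m A *m v) 0 0.

Definition unit_ket N (v : 'cV[C]_N) : Prop := (v^t* *m v) 0 0 = 1.

Definition ketbra N (v : 'cV[C]_N) : 'M[C]_N := v *m v^t*.

Definition is_state N (A : 'M[C]_N) : Prop := psdmx A /\ \tr A = 1.

(* 'M_r('M_N) is identified with the operators on C^r (x) C^N, so that applying
   Phi to each block is id_r (x) Phi. *)
Definition completely_positive N M (Phi : 'M[C]_N -> 'M[C]_M) : Prop :=
  forall (r : nat) (A : 'I_r -> 'I_r -> 'M[C]_N),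
    psdmx (\mxblock_(i < r, j < r) A i j) ->
    psdmx (\mxblock_(i < r, j < r) Phi (A i j)).

Definition trace_nonincreasing N M (Phi : 'M[C]_N -> 'M[C]_M) : Prop :=
  forall rho, psdmx rho -> \tr (Phi rho) <= \tr rho.

Definition quantum_operation N M (Phi : {linear 'M[C]_N -> 'M[C]_M}) : Prop :=
  completely_positive Phi /\ trace_nonincreasing Phi.

Definition tens_ket d n (v : 'I_n -> 'cV[C]_d) : 'cV[C]_(tdim d n) :=
  \col_i \prod_(a < n) v a (word i a) 0.

Definition tens_op d n (rho : 'I_n -> 'M[C]_d) : 'M[C]_(tdim d n) :=
  \matrix_(i, j) \prod_(a < n) rho a (word i a) (word j a).

Definition perm_word d m (s : 'S_m) (w : {ffun 'I_m -> 'I_d}) :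
  {ffun 'I_m -> 'I_d} := [ffun a => w (s^-1%g a)].

(* The linear extension of rho_1 (x) ... (x) rho_m |->
   rho_(s 1) (x) ... (x) rho_(s m); see perm_op_tens. *)
Definition perm_op d m (s : 'S_m) (A : 'M[C]_(tdim d m)) : 'M[C]_(tdim d m) :=
  \matrix_(i, j) A (enum_rank (perm_word s (word i)))
                   (enum_rank (perm_word s (word j))).

Definition perm_invariant_output d N m
    (Phi : 'M[C]_N -> 'M[C]_(tdim d m)) : Prop :=
  forall (s : 'S_m) (rho : 'M[C]_N), perm_op s (Phi rho) = Phi rho.

Definition cat_word d k m (hkm : (k <= m)%N)
    (s : {ffun 'I_k -> 'I_d}) (u : {ffun 'I_(m - k) -> 'I_d}) :
  {ffun 'I_m -> 'I_d} :=
  [ffun a => match fintype.split (cast_ord (esym (subnKC hkm)) a) with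
             | inl b => s b
             | inr c => u c
             end].

(* Partial trace over the last m - k tensor factors. *)
Definition ptrace d k m (hkm : (k <= m)%N) (A : 'M[C]_(tdim d m)) :
  'M[C]_(tdim d k) :=
  \matrix_(i, j) \sum_(u : {ffun 'I_(m - k) -> 'I_d})
    A (enum_rank (cat_word hkm (word i) u))
      (enum_rank (cat_word hkm (word j) u)).

Lemma perm_op_tens d m (s : 'S_m) (rho : 'I_m -> 'M[C]_d) :
  perm_op s (tens_op rho) = tens_op (fun a => rho (s a)).
Proof.
apply/matrixP => i j; rewrite !mxE (reindex_inj (@perm_inj _ s)) /=.
by apply: eq_bigr => a _; rewrite /word !enum_rankK !ffunE permK.
Qed.

Lemma ptrace_tens d k m (hkm : (k <= m)%N) (rho : 'I_m -> 'M[C]_d) :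
  ptrace hkm (tens_op rho) =
  (\prod_(c < m - k) \tr (rho (cast_ord (subnKC hkm) (rshift k c))))
    *: tens_op (fun b => rho (widen_ord hkm b)).
Proof.
apply/matrixP => i j; rewrite !mxE.
rewrite /mxtrace bigA_distr_bigA /= mulr_suml; apply: eq_bigr => u _.
rewrite !mxE /word !enum_rankK.
rewrite (reindex (cast_ord (subnKC hkm))) /=; last first.
  by exists (cast_ord (esym (subnKC hkm))) => a _; rewrite ?cast_ordK ?cast_ordKV.
rewrite big_split_ord /= mulrC; congr (_ * _); apply: eq_bigr => a _.
  by rewrite /cat_word !ffunE cast_ordK
    (unsplitK (inr a) : fintype.split (rshift _ a) = _).
rewrite /cat_word !ffunE cast_ordK
  (unsplitK (inl a) : fintype.split (lshift _ a) = _).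
by congr (rho _ _ _); apply: val_inj.
Qed.

End Operators.

Section MeasureAndPrepare.
Variable R : realType.
Local Notation C := R[i].

(* mu (dy) = tr[M(dy) rho] *)
Definition outcome_measure (disp : measure_display) (Y : measurableType disp) N
    (M : set Y -> 'M[C]_N) (rho : 'M[C]_N)
    (mu : {measure set Y -> \bar R}) : Prop :=
  forall A, measurable A -> mu A = (complex.Re (\tr (M A *m rho)))%:E.

(* Countable additivity is expressed weakly: tr[M(.) rho] is a measure for each
   positive rho.  The total mass is only required to satisfy M(Y) <= 1. *)
Definition sub_povm (disp : measure_display) (Y : measurableType disp) N
    (M : set Y -> 'M[C]_N) : Prop :=
  [/\ forall A, measurable A -> psdmx (M A),
      forall rho, psdmx rho -> exists mu, outcome_measure M rho mu
    & psdmx (1%:M - M setT)].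

Definition measurable_opfun (disp : measure_display) (Y : measurableType disp)
    N (sigma : Y -> 'M[C]_N) : Prop :=
  forall i j, measurable_fun setT (fun y => complex.Re (sigma y i j)) /\
              measurable_fun setT (fun y => complex.Im (sigma y i j)).

Definition op_integral (disp : measure_display) (Y : measurableType disp) N
    (mu : {measure set Y -> \bar R}) (sigma : Y -> 'M[C]_N) : 'M[C]_N :=
  \matrix_(i, j) Complex (\int[mu]_(y in setT) complex.Re (sigma y i j))
                         (\int[mu]_(y in setT) complex.Im (sigma y i j)).

(* The formula rho |-> \int tr[M(dy) rho] sigma_y is imposed on positive rho,
   where tr[M(dy) rho] is a (positive, finite) measure; as positive operators
   span all operators it determines the linear map Phi. *)
Definition pm_protocol N M (Phi : {linear 'M[C]_N -> 'M[C]_M}) : Prop :=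
  quantum_operation Phi /\
  exists (disp : measure_display) (Y : measurableType disp)
         (E : set Y -> 'M[C]_N) (sigma : Y -> 'M[C]_M),
    [/\ sub_povm E,
        forall y, is_state (sigma y),
        measurable_opfun sigma
      & forall (rho : 'M[C]_N) (mu : {measure set Y -> \bar R}),
          psdmx rho -> outcome_measure E rho mu ->
          Phi rho = op_integral mu sigma].

End MeasureAndPrepare.

Section Fidelity.
Variable R : realType.
Local Notation C := R[i].
Variables d n k m : nat.
Hypothesis hkm : (k <= m)%N.
Implicit Types (Phi : 'M[C]_(tdim d n) -> 'M[C]_(tdim d m)) (v : 'cV[C]_d).

Definition input_state v : 'M[C]_(tdim d n) := tens_op (fun=> ketbra v).

(* The quantities under Re below are real and nonnegative when Phi is
   positive. *)
Definition succ_prob Phi v : R := complex.Re (\tr (Phi (input_state v))).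

Definition overlap Phi v : R :=
  let w : 'cV[C]_(tdim d k) := tens_ket (fun=> v) in
  complex.Re ((w^t* *m ptrace hkm (Phi (input_state v)) *m w) 0 0).

Definition fidelity Phi v : R := overlap Phi v / succ_prob Phi v.

Definition is_prior (X : choiceType) (p : X -> R) : Prop :=
  (forall x, 0 <= p x) /\ (\esum_(x in [set: X]) (p x)%:E = 1)%E.

Definition average (X : choiceType) (p f : X -> R) : R :=
  fine (\esum_(x in [set: X]) (p x * f x)%:E).

Definition avg_succ_prob Phi (X : choiceType) (psi : X -> 'cV[C]_d)
    (p : X -> R) : R :=
  average p (fun x => succ_prob Phi (psi x)).

Definition avg_fidelity Phi (X : choiceType) (psi : X -> 'cV[C]_d)
    (p : X -> R) : R :=
  average p (fun x => overlap Phi (psi x)) / avg_succ_prob Phi psi p.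

End Fidelity.

(* Main.v *)
Require Import Defs.
From HB Require Import structures.
From mathcomp Require Import all_boot all_order all_algebra fingroup perm.
From mathcomp Require Import all_classical all_reals all_analysis.
From mathcomp Require Import complex ring lra zify.
Set Implicit Arguments.
Unset Strict Implicit.
Unset Printing Implicit Defensive.
Import Order.TTheory GRing.Theory Num.Theory.
Import numFieldNormedType.Exports.
Local Open Scope classical_set_scope.
Local Open Scope ring_scope.
Local Open Scope sesquilinear_scope.

(* By complete positivity the Choi operator of C is positive, and since the
   output of C is permutation invariant so is the positive square root of the
   Choi operator.  The columns of this square root form a dilation
   C(x x^* ) = sum_l tr_K |v_l><v_l| in which the v_l are symmetric vectors of
   (C^d (x) C^d)^(x)m, linear in x.  The protocol measures the dilated output
   in the coherent states z^(x)m, z in C^D with D = d^2, and prepares the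
   reduction of the normalised z^(x)m.

   An integral over all z is avoided: m-fold coherent states resolve the
   identity of the symmetric subspace as soon as the z_j, with weights w_j,
   have the moments of a Gaussian vector up to degree m.  Such a finite design
   is a product of one-dimensional ones, each of which combines a Gauss-Laguerre
   quadrature for |z|^2 with roots of unity for the phase; both are spectral
   measures of explicit normal matrices.

   For an effect 0 <= g <= 1 on the first k systems and v symmetric, let
   v_z = <z^(m-k)|v> be the partial amplitude and let a = <v|g (x) 1|v> and b be
   the expectations of g on the original and on the prepared state.  Summing
   <r_z|g|r_z> over the design, where r_z is the component of v_z orthogonal to
   z^k, gives 0 <= a/r - 2a + b <= (1/r - 1)|v|^2 with
   r = dim Sym^(m-k) / dim Sym^m >= 1 - (D-1)k/m, hence |a - b| <= 2kD/m. *)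

(** * Finite coherent-state designs *)

Section Spectral.
Variable C : numClosedFieldType.

Lemma mxtrC N M (A : 'M[C]_(N, M)) i j : (A ^t*) i j = (A j i)^*.
Proof. by rewrite !mxE. Qed.

Lemma trmxCD N M (A B : 'M[C]_(N, M)) : (A + B)^t* = A^t* + B^t*.
Proof. by apply/matrixP => i j; rewrite !(mxE, mxtrC) rmorphD. Qed.

Lemma trmxCZ N M c (A : 'M[C]_(N, M)) : (c *: A)^t* = c^* *: A^t*.
Proof. by apply/matrixP => i j; rewrite !(mxE, mxtrC) rmorphM. Qed.

Lemma trmxCM N M L (A : 'M[C]_(N, M)) (B : 'M[C]_(M, L)) :
  (A *m B)^t* = B^t* *m A^t*.
Proof. by rewrite trmx_mul map_mxM. Qed.

Lemma sesqE N (A : 'M[C]_N) (v w : 'cV[C]_N) :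
  (v^t* *m A *m w) 0 0 = \sum_i \sum_j (v i 0)^* * A i j * w j 0.
Proof.
rewrite mxE exchange_big /=; apply: eq_bigr => j _.
by rewrite mxE mulr_suml; apply: eq_bigr => i _; rewrite mxtrC.
Qed.

(** Stated over a general closed field for use in the quadratures; at [R[i]] it is convertible with
    [psdmx]. *)
Definition psd N (A : 'M[C]_N) := forall v : 'cV[C]_N, 0 <= (v^t* *m A *m v) 0 0.

Lemma sesq_delta N (A : 'M[C]_N) i j :
  ((delta_mx i 0 : 'cV[C]_N)^t* *m A *m (delta_mx j 0 : 'cV[C]_N)) 0 0 = A i j.
Proof. by rewrite -colE mxE trmx_delta map_delta_mx -rowE mxE. Qed.

(** Polarisation: positivity at e_i + c e_j makes c A_ij + c^* A_ji real for every c, and the cases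
    c = 1 and c = 'i together give A_ij = (A_ji)^*. *)
Lemma psd_herm N (A : 'M[C]_N) : psd A -> A^t* = A.
Proof.
move=> Apsd; apply/matrixP => i j; rewrite mxtrC.
have Aii l : A l l \is Num.real.
  by rewrite -(sesq_delta A l l); apply: ger0_real; apply: Apsd.
have real_form c : c * A i j + c^* * A j i \is Num.real.
  have := Apsd (delta_mx i 0 + c *: delta_mx j 0).
  rewrite trmxCD trmxCZ !mulmxDl !mulmxDr -!scalemxAl -!scalemxAr.
  have mxD (X Y : 'M[C]_1) : (X + Y) 0 0 = X 0 0 + Y 0 0 by rewrite mxE.
  have mxZ a (X : 'M[C]_1) : (a *: X) 0 0 = a * X 0 0 by rewrite mxE.
  rewrite !(mxD, mxZ) !sesq_delta.
  move=> /ger0_real; set x := (X in X \is _ -> _).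
  have -> : c * A i j + c^* * A j i = x - (A i i + `|c| ^+ 2 * A j j).
    by rewrite /x normCK; ring.
  by move=> xr; rewrite rpredB// rpredD// rpredM// rpredX// normr_real.
have := real_form 1; have := real_form 'i.
rewrite !CrealE !rmorphD !rmorphM /= !conjCK conjC1 conjCi !mul1r => /eqP e1 /eqP e2.
have e3 : (A i j)^* - (A j i)^* = A j i - A i j.
  apply: (mulfI (neq0Ci C)).
  apply/eqP; rewrite -subr_eq0 -oppr_eq0; apply/eqP.
  by rewrite -[RHS](subrr ('i * A i j + - 'i * A j i)) -{1}e1; ring.
suff : 2 * (A j i)^* = 2 * A i j by apply: mulfI; rewrite pnatr_eq0.
have -> : 2 * A i j = (A i j + A j i) - (A j i - A i j) by ring.
by rewrite -e2 -e3; ring.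
Qed.

Lemma psd_normal N (A : 'M[C]_N) : psd A -> A \is normalmx.
Proof. by move=> /psd_herm Ah; apply/normalmxP; rewrite Ah. Qed.

Lemma psd_spectral_diag_ge0 N (A : 'M[C]_N) j :
  psd A -> 0 <= spectral_diag A 0 j.
Proof.
move=> Apsd; have /orthomx_spectralP := psd_normal Apsd.
set P := spectralmx A; set sp := spectral_diag A => eA.
have Pu : P \in unitmx by apply: spectral_unit.
have iP : invmx P = P^t* by apply/invmx_unitary/spectral_unitarymx.
have eD : diag_mx sp = P *m A *m P^t*.
  by rewrite eA -iP !mulmxA mulmxK // mulmxV // mul1mx.
have := Apsd (P^t* *m delta_mx j 0).
rewrite trmxCM trmxCK !mulmxA -(mulmxA _ P A) -(mulmxA _ (P *m A)) -eD.
by rewrite sesq_delta mxE eqxx.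
Qed.

(* The weights and nodes are the spectral measure of M at x 0. *)
Lemma spectral_moments q (M : 'M[C]_q) (x : nat -> 'cV[C]_q) T :
    M \is normalmx -> (forall t, (t < T)%N -> x t.+1 = M *m x t) ->
  exists w : 'I_q -> C, (forall j, 0 <= w j) /\
    forall t t', (t <= T)%N -> (t' <= T)%N ->
      \sum_j w j * spectral_diag M 0 j ^+ t * (spectral_diag M 0 j ^+ t')^* =
      \sum_i x t i 0 * (x t' i 0)^*.
Proof.
move=> /orthomx_spectralP.
set P := spectralmx M; set sp := spectral_diag M => eM xS.
have Pu : P \in unitmx by apply: spectral_unit.
have iP : invmx P = P^t* by apply/invmx_unitary/spectral_unitarymx.
have ePx t j : (t <= T)%N -> (P *m x t) j 0 = sp 0 j ^+ t * (P *m x 0%N) j 0.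
  elim: t => [|t IH] tT; first by rewrite expr0 mul1r.
  rewrite xS // eM !mulmxA mulmxV // mul1mx -mulmxA mul_diag_mx mxE IH 1?ltnW //.
  by rewrite exprS mulrA.
exists (fun j => (P *m x 0%N) j 0 * ((P *m x 0%N) j 0)^*); split=> [j|t t' tT t'T].
  by rewrite -normCK exprn_ge0.
have dotE (u v : 'cV[C]_q) : \sum_i u i 0 * (v i 0)^* = (v^t* *m u) 0 0.
  by rewrite mxE; apply: eq_bigr => i _; rewrite mxtrC mulrC.
have -> : \sum_i x t i 0 * (x t' i 0)^* = ((P *m x t')^t* *m (P *m x t)) 0 0.
  by rewrite dotE trmxCM -mulmxA -iP mulKmx.
rewrite -(dotE (P *m x t) (P *m x t')); apply: eq_bigr => j _.
by rewrite (ePx t) // (ePx t') // rmorphM; ring.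
Qed.
End Spectral.

(** * Gauss-Laguerre quadrature for the squared modulus *)

Section Quadrature.
Variable C : numClosedFieldType.

(* Jacobi matrix of the Laguerre polynomials; x^t has coordinates
   t! 'C(t, i) in the (sign-normalised) Laguerre basis. *)
Definition laguerre_jacobi m : 'M[C]_m.+1 :=
  \matrix_(i, j) ((i == j)%:R * (2 * i + 1)%:R + (i.+1 == j :> nat)%:R * j%:R
                 + (j.+1 == i :> nat)%:R * i%:R).

Lemma sum_ord_natl m (F : nat -> C) a :
  \sum_(j < m.+1) (j == a :> nat)%:R * F j = (a < m.+1)%:R * F a.
Proof.
case: ltnP => am.
  rewrite (bigD1 (Ordinal am)) //= eqxx big1 ?addr0 // => j ja.
  by rewrite (_ : (j == a :> nat) = false) ?mul0r //; apply/negbTE.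
rewrite mul0r big1 // => j _; rewrite (_ : (j == a :> nat) = false) ?mul0r //.
by apply/negbTE; rewrite neq_ltn (leq_trans (ltn_ord j)).
Qed.

(** The form is a sum of squares (i + 1) |x_i + x_(i+1)|^2, where x extends v by zero past index
    m. *)
Lemma laguerre_jacobi_psd m : psd (laguerre_jacobi m).
Proof.
move=> v; pose x (i : nat) : C := if insub i is Some i' then v i' 0 else 0.
have xE (i : 'I_m.+1) : v i 0 = x i by rewrite /x valK.
have xm i : (m < i)%N -> x i = 0.
  by move=> mi; rewrite /x insubF // ltnNge mi.
suff -> : (v^t* *m laguerre_jacobi m *m v) 0 0 =
    \sum_(i < m.+1) i.+1%:R * `|x i + x i.+1| ^+ 2.
  by apply: sumr_ge0 => i _; rewrite mulr_ge0 ?exprn_ge0.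
rewrite sesqE.
transitivity (\sum_(i < m.+1) ((2 * i + 1)%:R * ((x i)^* * x i)
   + i.+1%:R * ((x i)^* * x i.+1) + i%:R * ((x i)^* * x i.-1))).
  apply: eq_bigr => i _.
  have := sum_ord_natl m (fun j => (x i)^* * (2 * i + 1)%:R * x j) i.
  have := sum_ord_natl m (fun j => (x i)^* * j%:R * x j) i.+1.
  have := sum_ord_natl m (fun j => if i == 0%N :> nat then 0 else (x i)^* * i%:R * x j) i.-1.
  rewrite ltn_ord (leq_ltn_trans (leq_pred i)) // !mul1r => e1 e2 e3.
  have {}e2 : \sum_(j < m.+1) (j == i.+1 :> nat)%:R * ((x i)^* * j%:R * x j) = (x i)^* * i.+1%:R * x i.+1.
    rewrite e2; case: ltnP => mi; first by rewrite mul1r.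
    by rewrite (xm i.+1) // !mulr0.
  transitivity (\sum_(j < m.+1) (j == i :> nat)%:R * ((x i)^* * (2 * i + 1)%:R * x j)
    + \sum_(j < m.+1) (j == i.+1 :> nat)%:R * ((x i)^* * j%:R * x j)
    + \sum_(j < m.+1) (j == i.-1 :> nat)%:R * (if i == 0%N :> nat then 0 else (x i)^* * i%:R * x j)).
    rewrite -!big_split /=; apply: eq_bigr => j _; rewrite mxE !xE.
    rewrite (eq_sym i.+1) (_ : (i == j) = (j == i :> nat)); last exact: eq_sym.
    by case: (i : nat) => [|i'] /=; rewrite ?eqSS; ring.
  rewrite e1 e2 e3; case: (i : nat) => [|i'] /=; last by ring.
  by ring.
(* [G] collects the terms of the expanded squares that have to move by one index. No boundary term
   survives: G 0 has the factor 0, and G m.+1 contains x m.+1 = 0. *)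
pose G i : C := i%:R * ((x i)^* * x i.-1) + i%:R * ((x i)^* * x i).
have shiftG : \sum_(i < m.+1) G i = \sum_(i < m.+1) G i.+1.
  rewrite big_ord_recl [RHS]big_ord_recr /= [X in X + _](_ : G 0%N = 0); last by rewrite /G !mul0r addr0.
  by rewrite add0r (_ : G m.+1 = 0) ?addr0 // /G xm // conjC0 !mul0r !mulr0 addr0.
apply/eqP; rewrite -subr_eq0 -sumrB; apply/eqP.
rewrite -[RHS](subrr (\sum_(i < m.+1) G i.+1)) -{1}shiftG -sumrB.
apply: eq_bigr => i _; rewrite natrD natrM normCK rmorphD /G /=.
by rewrite -(natr1 i); ring.
Qed.

(** The numbers t! are the moments of the exponential law, which is the law of |z|^2 for a complex
    Gaussian z. They arise because x 0 is the first basis vector and x t has first coordinate t!.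
    The nodes are eigenvalues of a positive matrix. *)
Lemma laguerre_quadrature m : exists (q : nat) (w z : 'I_q -> C),
  [/\ forall j, 0 <= w j, forall j, 0 <= z j &
      forall t, (t <= m)%N -> \sum_j w j * z j ^+ t = t`!%:R].
Proof.
pose x (t : nat) : 'cV[C]_m.+1 := \col_i (t`! * 'C(t, i))%:R.
have xS t : (t < m)%N -> x t.+1 = laguerre_jacobi m *m x t.
  move=> tm; apply/colP => i; rewrite !mxE.
  pose y j : C := (t`! * 'C(t, j))%:R.
  transitivity (\sum_(j < m.+1) (j == i :> nat)%:R * ((2 * i + 1)%:R * y j)
    + \sum_(j < m.+1) (j == i.+1 :> nat)%:R * (j%:R * y j)
    + \sum_(j < m.+1) (j == i.-1 :> nat)%:R * (i%:R * y j)).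
    rewrite (sum_ord_natl m (fun j => (2 * i + 1)%:R * y j)).
    rewrite (sum_ord_natl m (fun j => j%:R * y j)).
    rewrite (sum_ord_natl m (fun j => i%:R * y j)).
    rewrite ltn_ord (leq_ltn_trans (leq_pred i)) // !mul1r.
    (* Cutting the Jacobi matrix off at size m + 1 does no harm: for t < m the first missing
       coordinate of x t contains 'C(t, m.+1) = 0. *)
    have -> : (i.+1 < m.+1)%:R * (i.+1%:R * y i.+1) = i.+1%:R * y i.+1.
      case: ltnP => [_|mi]; first by rewrite mul1r.
      by rewrite /y bin_small ?muln0 ?mulr0 // (leq_trans tm) // ltnW.
    rewrite /y -!natrM -!natrD; congr _%:R.
    case: (i : nat) => [|i'] /=; first by rewrite !bin0 !bin1 factS; lia.
    (* Pascal's rule and two instances of the absorption identity (j + 1) 'C(t, j + 1) = (t - j)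
       'C(t, j) reduce the recurrence to polynomial arithmetic. *)
    rewrite factS binS; have := mul_bin_left t i'; have := mul_bin_left t i'.+1.
    case: (ltngtP t i') => [ti|ti|->].
    - by rewrite !bin_small ?muln0 //; lia.
    - set f := t`!; set a := 'C(t, i'); set b := 'C(t, i'.+1); set c := 'C(t, i'.+2).
      have -> : (t - i')%N = (t - i'.+1).+1 by lia.
      have -> : t = (i'.+1 + (t - i'.+1))%N by lia.
      move: (t - i'.+1)%N => r /= e1 e2; nia.
    - by rewrite binn (bin_small (ltnSn i')) (bin_small (ltnW (ltnSn i'.+1))) !muln0 => *; lia.
  rewrite -!big_split /=; apply: eq_bigr => j _; rewrite !mxE -/(y j).
  rewrite (eq_sym i.+1) (_ : (i == j) = (j == i :> nat)); last exact: eq_sym.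
  by case: (i : nat) => [|i'] /=; rewrite ?eqSS; ring.
have [w [w0 ew]] := spectral_moments (psd_normal (@laguerre_jacobi_psd m)) xS.
exists m.+1, w, (spectral_diag (laguerre_jacobi m) 0); split=> // [j|t tm].
  exact/psd_spectral_diag_ge0/laguerre_jacobi_psd.
transitivity (\sum_i x t i 0 * (x 0%N i 0)^*).
  by rewrite -ew //; apply: eq_bigr => j _; rewrite expr0 conjC1 mulr1.
rewrite big_ord_recl big1 ?addr0 => [|i _]; first by rewrite !mxE !bin0 muln1 conjC1 mulr1.
by rewrite !mxE bin0n muln0 conjC0 mulr0.
Qed.
End Quadrature.

(** * Gaussian designs: phases, products and moments with powers of the norm *)

Section Design.
Variable C : numClosedFieldType.

(** The cyclic shift on m + 1 points is unitary and maps e_t to e_(t+1). Its spectral measure at e_0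
    sits on roots of unity, and the exponents 0, ..., m stay distinct modulo m + 1. *)
Lemma cyclic_quadrature m : exists (q : nat) (w z : 'I_q -> C),
  (forall j, 0 <= w j) /\
  forall t t', (t <= m)%N -> (t' <= m)%N ->
    \sum_j w j * z j ^+ t * (z j ^+ t')^* = (t == t')%:R.
Proof.
pose s : 'S_m.+1 := perm (@addIr _ (inord 1 : 'I_m.+1)).
pose M : 'M[C]_m.+1 := perm_mx s^-1%g.
pose x (t : nat) : 'cV[C]_m.+1 := delta_mx (inord t) 0.
have Mn : M \is normalmx.
  apply/normalmxP.
  by rewrite tr_perm_mx map_perm_mx -!perm_mxM mulgV mulVg.
have xS t : (t < m)%N -> x t.+1 = M *m x t.
  move=> tm; have sE : s (inord t) = inord t.+1.
    rewrite permE; apply/val_inj; rewrite /= !inordK ?modn_small //; lia.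
  apply/colP => i; rewrite -colE !mxE -sE eqxx andbT; congr (nat_of_bool _)%:R.
  by apply/eqP/eqP => [->|<-]; rewrite ?permK ?permKV.
have [w [w0 ew]] := spectral_moments Mn xS.
exists m.+1, w, (spectral_diag M 0); split=> // t t' tm t'm.
rewrite ew // (bigD1 (inord t)) //= big1 ?addr0 => [|i it].
  by rewrite !mxE !eqxx mul1r andbT -val_eqE /= !inordK // conjC_nat.
by rewrite !mxE (negbTE it) mul0r.
Qed.

(** Polar coordinates: the modulus is the square root of a Laguerre node, and the independent phase
    kills all moments with t <> t'. *)
Lemma complex_gaussian_quadrature m : exists (K : finType) (w z : K -> C),
  (forall j, 0 <= w j) /\
  forall t t', (t <= m)%N -> (t' <= m)%N ->
    \sum_j w j * z j ^+ t * (z j ^+ t')^* = (t == t')%:R * t`!%:R.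
Proof.
have [q [w [z [w0 z0 ew]]]] := laguerre_quadrature C m.
have [q' [w' [z' [w'0 ew']]]] := cyclic_quadrature m.
exists ('I_q * 'I_q')%type, (fun j => w j.1 * w' j.2),
  (fun j => sqrtC (z j.1) * z' j.2); split=> [j|t t' tm t'm].
  exact: mulr_ge0.
transitivity ((\sum_j w j * (sqrtC (z j) ^+ t * (sqrtC (z j) ^+ t')^*))
   * (\sum_j w' j * z' j ^+ t * (z' j ^+ t')^*)).
  rewrite big_distrlr pair_bigA /=; apply: eq_bigr => j _.
  by rewrite !exprMn rmorphM /=; ring.
rewrite ew' // mulrC; case: eqP => [<-|_]; last by rewrite !mul0r.
rewrite !mul1r -ew //; apply: eq_bigr => j _; congr (_ * _).
have /CrealP -> : sqrtC (z j) ^+ t \is Num.real by rewrite rpredX // ger0_real ?sqrtC_ge0.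
by rewrite -exprMn -expr2 sqrtCK.
Qed.

(** The right-hand sides are the mixed moments of a standard complex Gaussian vector. The degree is
    bounded in each coordinate separately, so that products of one-dimensional designs qualify. *)
Definition is_design (A J : finType) m (w : J -> C) (z : J -> A -> C) :=
  (forall j, 0 <= w j) /\
  forall t t' : {ffun A -> nat}, (forall c, t c <= m)%N -> (forall c, t' c <= m)%N ->
    \sum_j w j * \prod_c z j c ^+ t c * (\prod_c z j c ^+ t' c)^* =
    (t == t')%:R * \prod_c (t c)`!%:R.

Lemma design_exists (A : finType) m : exists (J : finType) (w : J -> C) (z : J -> A -> C),
  is_design m w z.
Proof.
have [K [u [zeta [u0 eu]]]] := complex_gaussian_quadrature m.
exists {ffun A -> K}, (fun f : {ffun A -> K} => \prod_c u (f c)),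
  (fun (f : {ffun A -> K}) c => zeta (f c)); split=> [f|t t' tm t'm].
  exact: prodr_ge0.
transitivity (\prod_c \sum_j u j * zeta j ^+ t c * (zeta j ^+ t' c)^*).
  rewrite bigA_distr_bigA /=; apply: eq_bigr => f _.
  by rewrite rmorph_prod -!big_split.
under eq_bigr do rewrite eu //; rewrite big_split /=; congr (_ * _).
case: (t =P t') => [->|tt'].
  by rewrite big1 // => c _; rewrite eqxx.
have [c tc] : exists c, t c != t' c.
  apply/existsP; rewrite -negb_forall; apply/negP => /forallP e.
  by apply: tt'; apply/ffunP => c; apply/eqP.
by rewrite (bigD1 c) //= (negbTE tc) mul0r.
Qed.

Lemma design_exists_ord (A : finType) m : exists (q : nat) (w : 'I_q -> C) (z : 'I_q -> A -> C),
  is_design m w z.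
Proof.
have [J [w [z [w0 dz]]]] := design_exists A m.
exists #|J|, (fun i => w (enum_val i)), (fun i => z (enum_val i)); split=> // t t' tm t'm.
rewrite -dz // [RHS](reindex (@enum_val J predT)) //.
exact/onW_bij/enum_val_bij.
Qed.

Definition rising a k := (\prod_(i < k) (a + i))%N.
Definition sqnorm (A : finType) (x : A -> C) := \sum_c x c * (x c)^*.

Lemma sqnorm_ge0 (A : finType) (x : A -> C) : 0 <= sqnorm x.
Proof. by apply: sumr_ge0 => c _; rewrite -normCK exprn_ge0. Qed.

Definition incr (A : finType) (t : {ffun A -> nat}) c : {ffun A -> nat} :=
  [ffun a => (t a + (a == c))%N].

Lemma prod_incr (A : finType) (t : {ffun A -> nat}) c (x : A -> C) :
  \prod_a x a ^+ incr t c a = \prod_a x a ^+ t a * x c.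
Proof.
transitivity (\prod_a x a ^+ t a * \prod_a x a ^+ (a == c)).
  by rewrite -big_split /=; apply: eq_bigr => a _; rewrite ffunE exprD.
congr (_ * _); rewrite (bigD1 c) //= eqxx big1 ?mulr1 // => a /negbTE ->.
by rewrite expr0.
Qed.

Lemma prod_fact_incr (A : finType) (t : {ffun A -> nat}) c :
  (\prod_a (incr t c a)`! = (t c).+1 * \prod_a (t a)`!)%N.
Proof.
rewrite (bigD1 c) //= [in RHS](bigD1 c) //= ffunE eqxx addn1 factS mulnA.
by congr (_ * _)%N; apply: eq_bigr => a /negbTE ac; rewrite ffunE ac addn0.
Qed.

Lemma sum_incr (A : finType) (t : {ffun A -> nat}) c :
  (\sum_a incr t c a = (\sum_a t a).+1)%N.
Proof.
transitivity (\sum_a t a + \sum_a (a == c))%N.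
  by rewrite -big_split /=; apply: eq_bigr => a _; rewrite ffunE.
have -> : (\sum_a (a == c) = 1)%N.
  by rewrite (bigD1 c) //= eqxx big1 // => a /negbTE ->.
by rewrite addn1.
Qed.

Lemma incr_inj (A : finType) (t t' : {ffun A -> nat}) c :
  (incr t c == incr t' c) = (t == t').
Proof.
apply/eqP/eqP => [/ffunP e|-> //]; apply/ffunP => a.
by have := e a; rewrite !ffunE => /addIn.
Qed.

(** Induction on k: expanding one factor |z|^2 as the sum of |z_c|^2 raises both exponents at c by
    one. The factors t_c + 1 so produced add up to |t| + #|A|, the lowest factor of the rising
    factorial. *)
Lemma design_norm_moments (A J : finType) m (w : J -> C) (z : J -> A -> C) :
  is_design m w z ->
  forall k (t t' : {ffun A -> nat}), (forall c, t c + k <= m)%N -> (forall c, t' c + k <= m)%N ->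
    \sum_j w j * sqnorm (z j) ^+ k * \prod_c z j c ^+ t c * (\prod_c z j c ^+ t' c)^* =
    (t == t')%:R * (\prod_c (t c)`! * rising (\sum_c t c + #|A|) k)%:R.
Proof.
move=> [w0 dz]; elim=> [|k IH] t t' tm t'm.
  rewrite /rising big_ord0 muln1 natr_prod -dz; last 2 first.
  - by move=> c; have := tm c; rewrite addn0.
  - by move=> c; have := t'm c; rewrite addn0.
  by apply: eq_bigr => j _; rewrite expr0 mulr1.
transitivity (\sum_c \sum_j w j * sqnorm (z j) ^+ k *
    \prod_a z j a ^+ incr t c a * (\prod_a z j a ^+ incr t' c a)^*).
  rewrite exchange_big /=; apply: eq_bigr => j _.
  rewrite exprSr {2}/sqnorm mulr_sumr mulr_sumr !mulr_suml; apply: eq_bigr => c _.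
  by rewrite !prod_incr rmorphM /=; ring.
transitivity (\sum_c (t == t')%:R *
    ((t c).+1 * \prod_a (t a)`! * rising ((\sum_a t a).+1 + #|A|) k)%:R : C).
  apply: eq_bigr => c _; rewrite IH.
  - by rewrite incr_inj prod_fact_incr sum_incr.
  - by move=> a; have := tm a; rewrite ffunE; case: (a == c); lia.
  - by move=> a; have := t'm a; rewrite ffunE; case: (a == c); lia.
rewrite -mulr_sumr -natr_sum; congr (_ * _%:R).
rewrite /rising big_ord_recl addn0 /=.
rewrite [in RHS](eq_bigr (fun i : 'I_k => ((\sum_a t a).+1 + #|A| + i)%N)); last first.
  by move=> i _; rewrite /bump /=; lia.
rewrite mulnA mulnAC -[LHS](big_distrl (_ : nat)) -!big_distrl /=.
rewrite [RHS]mulnC mulnA; congr (_ * _ * _)%N.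
by under eq_bigr do rewrite -addn1; rewrite big_split /= sum1_card.
Qed.
End Design.

(** * The de Finetti estimate *)

Section Words.
Variable A : finType.

(** The occupation numbers of w, which label its orbit under permutations of the positions. *)
Definition cnt m (w : {ffun 'I_m -> A}) : {ffun A -> nat} :=
  [ffun c => \sum_i (w i == c)]%N.

Lemma prod_cnt (C : comNzRingType) m (w : {ffun 'I_m -> A}) (F : A -> C) :
  \prod_i F (w i) = \prod_c F c ^+ cnt w c.
Proof.
transitivity (\prod_c \prod_i F c ^+ (w i == c)); last first.
  by apply: eq_bigr => c _; rewrite ffunE expr_sum.
rewrite exchange_big /=; apply: eq_bigr => i _.
rewrite (bigD1 (w i)) //= eqxx expr1 big1 ?mulr1 // => c.
by rewrite eq_sym => /negbTE ->; rewrite expr0.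
Qed.

Lemma sum_cnt m (w : {ffun 'I_m -> A}) : (\sum_c cnt w c = m)%N.
Proof.
under eq_bigr do rewrite ffunE.
rewrite exchange_big /= -[RHS]card_ord -sum1_card; apply: eq_bigr => i _.
by rewrite (bigD1 (w i)) //= eqxx big1 // => c; rewrite eq_sym => /negbTE ->.
Qed.

Lemma cnt_le m (w : {ffun 'I_m -> A}) c : (cnt w c <= m)%N.
Proof. by rewrite -{2}(sum_cnt w) (bigD1 c) //= leq_addr. Qed.

Definition wperm m (s : 'S_m) (w : {ffun 'I_m -> A}) : {ffun 'I_m -> A} :=
  [ffun i => w (s i)].

Lemma lift_perm_bij m :
  bijective (fun p : 'I_m.+1 * 'S_m => lift_perm ord0 p.1 p.2).
Proof.
apply: inj_card_bij; last by rewrite card_prod card_ord !card_Sn factS.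
move=> [j s] [j' s'] /= /permP e.
have jj' : j = j' by have := e ord0; rewrite !lift_perm_id.
subst j'; congr (_, _); apply/permP => i.
by have := e (lift ord0 i); rewrite !lift_perm_lift => /lift_inj.
Qed.

(** Induction on m, sorting the permutations by the position j of w that supplies the first letter
    of w'; deleting that letter on both sides leaves words of length m. *)
Lemma count_perm_word m (w w' : {ffun 'I_m -> A}) :
  (\sum_(s : 'S_m) (wperm s w == w') = (cnt w == cnt w') * \prod_c (cnt w c)`!)%N.
Proof.
elim: m w w' => [|m IH] w w'.
  have E0 (u : {ffun 'I_0 -> A}) : cnt u = [ffun=> 0%N].
    by apply/ffunP => c; rewrite !ffunE big_ord0.
  rewrite !E0 eqxx mul1n [X in _ = X]big1 => [|c _]; last by rewrite ffunE.
  rewrite (eq_bigr (fun=> 1%N)) ?sum1_card ?card_Sn // => s _.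
  by rewrite (_ : wperm s w = w') ?eqxx //; apply/ffunP => -[].
pose dropw (u : {ffun 'I_m.+1 -> A}) j : {ffun 'I_m -> A} := [ffun i => u (lift j i)].
have cnt_drop (u : {ffun 'I_m.+1 -> A}) j : cnt u = incr (cnt (dropw u j)) (u j).
  apply/ffunP => c; rewrite !ffunE (bigD1_ord j) //= addnC eq_sym; congr (_ + _)%N.
  by apply: eq_bigr => i _; rewrite ffunE.
transitivity (\sum_j (w j == w' ord0) * ((cnt w == cnt w') *
    \prod_c (cnt (dropw w j) c)`!))%N.
  rewrite (reindex (fun p : 'I_m.+1 * 'S_m => lift_perm ord0 p.1 p.2)) /=; last first.
    by apply: onW_bij; apply: lift_perm_bij.
  rewrite -(pair_bigA _ (fun j s => (wperm (lift_perm ord0 j s) w == w') : nat)) /=.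
  apply: eq_bigr => j _.
  transitivity (\sum_(s : 'S_m) (w j == w' ord0) * (wperm s (dropw w j) == dropw w' ord0))%N.
    apply: eq_bigr => s _; rewrite mulnb; congr nat_of_bool.
    apply/eqP/andP => [<-|[/eqP e0 /eqP/ffunP e1]].
      rewrite ffunE lift_perm_id eqxx; split=> //.
      by apply/eqP/ffunP => i; rewrite !ffunE lift_perm_lift.
    apply/ffunP => i; case: (unliftP ord0 i) => [i' ->|->].
      by have := e1 i'; rewrite !ffunE lift_perm_lift.
    by rewrite ffunE lift_perm_id.
  rewrite -big_distrr /= IH; case: (w j =P w' ord0) => // e.
  by rewrite (cnt_drop w j) (cnt_drop w' ord0) e incr_inj.
case: (cnt w =P cnt w') => [e|_]; last first.
  by rewrite big1 // => j _; rewrite muln0.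
have c0 : (0 < cnt w (w' ord0))%N.
  by rewrite e ffunE (bigD1 ord0) //= eqxx.
(* Multiplying by the number of occurrences of the letter [w' ord0] in w restores the factorial
   lowered by the deletion; the same number counts the admissible j. *)
apply/eqP; rewrite -(eqn_pmul2r c0) mul1n big_distrl /=; apply/eqP.
transitivity (\sum_j (w j == w' ord0) * \prod_c (cnt w c)`!)%N.
  apply: eq_bigr => j _; rewrite mul1n -mulnA.
  case: (w j =P w' ord0) => [ej|_] //; congr (_ * _)%N.
  rewrite (cnt_drop w j) prod_fact_incr ej mulnC; congr (_ * _)%N.
  by rewrite [in LHS]ffunE eqxx addn1.
by rewrite -big_distrl /= mulnC [in RHS]ffunE.
Qed.

(** By [count_perm_word] the kernel is the sum of all permutation operators, which is m! times the
    projector onto symmetric functions. *)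
Lemma symmetric_reproduce (C : comNzRingType) m (v : {ffun 'I_m -> A} -> C) w :
  (forall s w, v (wperm s w) = v w) ->
  \sum_w' (cnt w == cnt w')%:R * (\prod_c (cnt w c)`!)%:R * v w' = m`!%:R * v w.
Proof.
move=> vs; transitivity (\sum_w' \sum_(s : 'S_m) (wperm s w == w')%:R * v w').
  by apply: eq_bigr => w' _; rewrite -natrM -count_perm_word natr_sum mulr_suml.
rewrite exchange_big /= -card_Sn -sum1_card natr_sum mulr_suml.
apply: eq_bigr => s _; rewrite (bigD1 (wperm s w)) //= eqxx big1 ?addr0.
  by rewrite vs.
by move=> w'; rewrite eq_sym => /negbTE ->; rewrite mul0r.
Qed.
End Words.

(** * Splitting a word into its first k and last m - k letters *)

Section CatWord.
Variables (A : finType) (k m : nat) (hkm : (k <= m)%N).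

(** [cat_word] over an arbitrary alphabet, as it is also applied to words of pairs. *)
Definition catw (s : {ffun 'I_k -> A}) (u : {ffun 'I_(m - k) -> A}) : {ffun 'I_m -> A} :=
  [ffun a => match fintype.split (cast_ord (esym (subnKC hkm)) a) with
             | inl b => s b
             | inr c => u c
             end].

Lemma catw_l s u b : catw s u (cast_ord (subnKC hkm) (lshift (m - k) b)) = s b.
Proof.
by rewrite ffunE cast_ordK (unsplitK (inl b) : fintype.split (lshift _ b) = _).
Qed.

Lemma catw_r s u c : catw s u (cast_ord (subnKC hkm) (rshift k c)) = u c.
Proof.
by rewrite ffunE cast_ordK (unsplitK (inr c) : fintype.split (rshift _ c) = _).
Qed.

Lemma big_catw_ord (T : Type) (idx : T) (op : Monoid.com_law idx) (F : 'I_m -> T) :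
  \big[op/idx]_i F i = op (\big[op/idx]_(b < k) F (cast_ord (subnKC hkm) (lshift (m - k) b)))
    (\big[op/idx]_(c < m - k) F (cast_ord (subnKC hkm) (rshift k c))).
Proof.
rewrite (reindex (cast_ord (subnKC hkm))) /=; last first.
  by exists (cast_ord (esym (subnKC hkm))) => a _; rewrite ?cast_ordK ?cast_ordKV.
by rewrite big_split_ord.
Qed.

Lemma catw_inj : injective (fun p : {ffun 'I_k -> A} * {ffun 'I_(m - k) -> A} => catw p.1 p.2).
Proof.
move=> [s u] [s' u'] /= /ffunP e; congr (_, _); apply/ffunP => a.
  by rewrite -(catw_l s u) e catw_l.
by rewrite -(catw_r s u) e catw_r.
Qed.

Lemma sum_catw (C : nmodType) (F : {ffun 'I_m -> A} -> C) :
  \sum_w F w = \sum_s \sum_u F (catw s u).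
Proof.
rewrite pair_bigA /= (reindex (fun p : {ffun 'I_k -> A} * {ffun 'I_(m - k) -> A} => catw p.1 p.2)) //=.
apply: onW_bij; apply: inj_card_bij catw_inj _.
by rewrite card_prod !card_ffun !card_ord -expnD subnKC.
Qed.

Lemma cnt_catw s u c : cnt (catw s u) c = (cnt s c + cnt u c)%N.
Proof.
rewrite !ffunE (@big_catw_ord _ _ addn) /=.
by congr (_ + _)%N; apply: eq_bigr => i _; rewrite ?catw_l ?catw_r.
Qed.
End CatWord.

Section Symmetric.
Variables (A : finType) (T : Type).

Definition symmetric_fun m (v : {ffun 'I_m -> A} -> T) := forall s w, v (wperm s w) = v w.

(** The number of permutations carrying w to w' is a product of factorials, hence positive, so one
    exists. *)
Lemma symmetric_cnt m (v : {ffun 'I_m -> A} -> T) w w' :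
  symmetric_fun v -> cnt w = cnt w' -> v w = v w'.
Proof.
move=> vs e; have := count_perm_word w w'.
rewrite e eqxx mul1n => e'.
have [s /eqP <-|n] := pickP (fun s : 'S_m => wperm s w == w'); first by rewrite vs.
have : (0 < \prod_c (cnt w' c)`!)%N by rewrite prodn_gt0 // => c; rewrite fact_gt0.
by rewrite -e' big1 // => s _; rewrite n.
Qed.

Lemma cnt_wperm m s (w : {ffun 'I_m -> A}) : cnt (wperm s w) = cnt w.
Proof.
apply/ffunP => c; rewrite !ffunE [RHS](reindex_inj (@perm_inj _ s)) /=.
by apply: eq_bigr => i _; rewrite ffunE.
Qed.

Lemma symmetric_catw k m (hkm : (k <= m)%N) (v : {ffun 'I_m -> A} -> T) s :
  symmetric_fun v -> symmetric_fun (fun u => v (catw hkm s u)).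
Proof.
move=> vs p u; apply: symmetric_cnt => //.
by apply/ffunP => c; rewrite !cnt_catw cnt_wperm.
Qed.
End Symmetric.

(** * Product vectors and their design averages *)

Section CoherentStates.
Variables (C : numClosedFieldType) (A : finType).

(** The coordinates of the n-fold tensor power of x in the word basis. *)
Definition zpow n (x : A -> C) (w : {ffun 'I_n -> A}) := \prod_i x (w i).

Lemma zpow_catw k m (hkm : (k <= m)%N) x s u :
  zpow x (catw hkm s u) = zpow x s * zpow x u.
Proof.
rewrite /zpow (@big_catw_ord k m hkm _ _ *%R) /=.
by congr (_ * _); apply: eq_bigr => i _; rewrite ?catw_l ?catw_r.
Qed.

Lemma zpow_norm n x : \sum_(w : {ffun 'I_n -> A}) zpow x w * (zpow x w)^* = sqnorm x ^+ n.
Proof.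
rewrite -[n in RHS]card_ord -prodr_const bigA_distr_bigA /=.
by apply: eq_bigr => w _; rewrite /zpow rmorph_prod -big_split.
Qed.

Lemma sqnorm_eq0 (x : A -> C) : sqnorm x = 0 -> forall a, x a = 0.
Proof.
move=> /eqP; rewrite psumr_eq0 => [/allP e a|a _]; last by rewrite -normCK exprn_ge0.
have := e a (mem_index_enum a).
by rewrite /= -normCK expf_eq0 normr_eq0 => /eqP.
Qed.

Lemma zpow0 n x (w : {ffun 'I_n -> A}) : (0 < n)%N -> sqnorm x = 0 -> zpow x w = 0.
Proof. by case: n w => // n w _ x0; rewrite /zpow big_ord_recl sqnorm_eq0 ?mul0r. Qed.

(** Combined with [symmetric_reproduce], this says that the weighted operators |z^m><z^m| sum to m!
    times the identity on symmetric vectors. *)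
Lemma design_words (J : finType) m wt (z : J -> A -> C) :
  is_design m wt z -> forall w w' : {ffun 'I_m -> A},
  \sum_j wt j * zpow (z j) w * (zpow (z j) w')^* =
    (cnt w == cnt w')%:R * (\prod_c (cnt w c)`!)%:R.
Proof.
move=> [_ dz] w w'; have := dz _ _ (cnt_le w) (cnt_le w').
rewrite natr_prod => <-.
by apply: eq_bigr => j _; rewrite /zpow !prod_cnt.
Qed.

(** Words of length m - k have counts at most m - k, which leaves room in the degree bound m for k
    factors |z|^2. *)
Lemma design_norm_words (J : finType) m k wt (z : J -> A -> C) (hkm : (k <= m)%N) :
  is_design m wt z -> forall u u' : {ffun 'I_(m - k) -> A},
  \sum_j wt j * sqnorm (z j) ^+ k * zpow (z j) u * (zpow (z j) u')^* =
    (cnt u == cnt u')%:R * (\prod_c (cnt u c)`!)%:R * (rising (m - k + #|A|) k)%:R.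
Proof.
move=> dz u u'; have cnt_lek (u0 : {ffun 'I_(m - k) -> A}) c : (cnt u0 c + k <= m)%N.
  by have := cnt_le u0 c; lia.
have := design_norm_moments dz (cnt_lek u) (cnt_lek u').
rewrite sum_cnt natrM mulrA => <-.
by apply: eq_bigr => j _; rewrite /zpow !prod_cnt.
Qed.
End CoherentStates.

(** * The estimate for one symmetric vector and an effect on k systems *)

Section DeFinetti.
Variable C : numClosedFieldType.

Definition form (I : finType) (g : I -> I -> C) (x y : I -> C) :=
  \sum_s \sum_s' (x s)^* * g s s' * y s'.

Lemma form_sum (I J : finType) (g : I -> I -> C) (c : J -> C) (x y : J -> I -> C) :
  \sum_j c j * form g (x j) (y j) =
  \sum_s \sum_s' g s s' * \sum_j c j * (x j s)^* * y j s'.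
Proof.
under eq_bigr do rewrite mulr_sumr.
rewrite exchange_big; apply: eq_bigr => s _ /=.
under eq_bigr do rewrite mulr_sumr.
rewrite exchange_big; apply: eq_bigr => s' _ /=; rewrite mulr_sumr.
by apply: eq_bigr => j _; ring.
Qed.

Lemma form_comb (I : finType) (g : I -> I -> C) a b (x y : I -> C) :
  let c s := a * x s - b * y s in
  form g c c = a^* * a * form g x x - a^* * b * form g x y
             - b^* * a * form g y x + b^* * b * form g y y.
Proof.
rewrite /form !mulr_sumr -!sumrB -big_split; apply: eq_bigr => s _ /=.
rewrite !mulr_sumr -!sumrB -big_split; apply: eq_bigr => s' _ /=.
by rewrite rmorphB !rmorphM /=; ring.
Qed.

Definition kid (I : finType) (s s' : I) : C := (s == s')%:R.

Lemma form_id (I : finType) (x y : I -> C) : form (@kid I) x y = \sum_s (x s)^* * y s.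
Proof.
apply: eq_bigr => s _; rewrite (bigD1 s) //= /kid eqxx mulr1 big1 ?addr0 // => s'.
by rewrite eq_sym => /negbTE ->; rewrite mulr0 mul0r.
Qed.

Variables (A J : finType) (k m : nat) (hkm : (k <= m)%N) (k_gt0 : (0 < k)%N).
Variables (wt : J -> C) (z : J -> A -> C) (dz : is_design m wt z).
Variables (v : {ffun 'I_m -> A} -> C) (vs : symmetric_fun v).
Local Notation Wk := {ffun 'I_k -> A}.
Local Notation cat := (catw hkm).

Definition amplitude j := \sum_w (zpow (z j) w)^* * v w.
Definition partial_amplitude j (s : Wk) :=
  \sum_(u : {ffun 'I_(m - k) -> A}) (zpow (z j) u)^* * v (cat s u).
Local Notation beta := amplitude.
Local Notation vz := partial_amplitude.

(** The quantity a = <v|g (x) 1|v>, with g acting on the first k systems. *)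
Definition local_form (g : Wk -> Wk -> C) (x : {ffun 'I_m -> A} -> C) :=
  \sum_u form g (fun s => x (cat s u)) (fun s => x (cat s u)).

(** This is m! b, with b the expectation of g on the prepared state: the measurement's factor 1 / m!
    is left out. *)
Definition mp_form (g : Wk -> Wk -> C) :=
  \sum_j wt j * ((beta j)^* * beta j) *
    (form g (@zpow C A k (z j)) (@zpow C A k (z j)) / sqnorm (z j) ^+ k).

Lemma wt_conj j : (wt j)^* = wt j.
Proof. by apply/CrealP/ger0_real; case: dz. Qed.

Lemma sqnorm_conj (B : finType) (x : B -> C) : (sqnorm x)^* = sqnorm x.
Proof. by apply/CrealP/ger0_real/sqnorm_ge0. Qed.

Lemma sum_amplitude w : \sum_j wt j * zpow (z j) w * beta j = m`!%:R * v w.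
Proof.
rewrite -symmetric_reproduce //.
transitivity (\sum_j \sum_w' wt j * zpow (z j) w * ((zpow (z j) w')^* * v w')).
  by apply: eq_bigr => j _; rewrite mulr_sumr.
rewrite exchange_big /=; apply: eq_bigr => w' _; rewrite -(design_words dz) mulr_suml.
by apply: eq_bigr => j _; ring.
Qed.

Lemma local_formE g : local_form g v =
  \sum_s \sum_s' g s s' * \sum_u (v (cat s u))^* * v (cat s' u).
Proof.
rewrite /local_form; under eq_bigr do rewrite -[form _ _ _]mul1r.
rewrite form_sum; apply: eq_bigr => s _; apply: eq_bigr => s' _.
by under eq_bigr do rewrite mul1r.
Qed.

Lemma sum_form_vz_vz g : \sum_j wt j * sqnorm (z j) ^+ k * form g (vz j) (vz j) =
  (rising (m - k + #|A|) k * (m - k)`!)%:R * local_form g v.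
Proof.
rewrite form_sum local_formE mulr_sumr; apply: eq_bigr => s _.
rewrite mulr_sumr; apply: eq_bigr => s' _; rewrite mulrCA; congr (_ * _).
transitivity (\sum_u (v (cat s u))^* * \sum_u' (\sum_j wt j * sqnorm (z j) ^+ k *
   zpow (z j) u * (zpow (z j) u')^*) * v (cat s' u')).
  under eq_bigr do rewrite /partial_amplitude rmorph_sum -mulrA big_distrlr mulr_sumr.
  rewrite exchange_big; apply: eq_bigr => u _ /=; rewrite mulr_sumr.
  under eq_bigr do rewrite mulr_sumr.
  rewrite exchange_big; apply: eq_bigr => u' _ /=.
  rewrite mulr_suml mulr_sumr; apply: eq_bigr => j _.
  by rewrite rmorphM /= conjCK; ring.
rewrite mulr_sumr; apply: eq_bigr => u _.
under eq_bigr do rewrite design_norm_words //.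
transitivity ((v (cat s u))^* * ((rising (m - k + #|A|) k)%:R * ((m - k)`!%:R * v (cat s' u)))).
  congr (_ * _); rewrite -(symmetric_reproduce u (symmetric_catw hkm s' vs)) mulr_sumr.
  by apply: eq_bigr => u' _; ring.
by rewrite natrM; ring.
Qed.

(** The z^(m-k) inside the partial amplitude and the explicit z^k recombine into z^m by [zpow_catw],
    so the resolution of the identity returns v. *)
Lemma sum_form_vz_z g : \sum_j wt j * beta j * form g (vz j) (@zpow C A k (z j)) =
  m`!%:R * local_form g v.
Proof.
rewrite form_sum local_formE mulr_sumr; apply: eq_bigr => s _.
rewrite mulr_sumr; apply: eq_bigr => s' _; rewrite mulrCA; congr (_ * _).
transitivity (\sum_u (v (cat s u))^* * \sum_j wt j * zpow (z j) (cat s' u) * beta j).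
  under eq_bigr do rewrite /partial_amplitude rmorph_sum mulr_sumr mulr_suml.
  rewrite exchange_big; apply: eq_bigr => u _ /=; rewrite mulr_sumr.
  by apply: eq_bigr => j _; rewrite zpow_catw rmorphM /= conjCK; ring.
rewrite mulr_sumr; apply: eq_bigr => u _; rewrite sum_amplitude; ring.
Qed.

Lemma sum_form_z_vz g : \sum_j wt j * (beta j)^* * form g (@zpow C A k (z j)) (vz j) =
  m`!%:R * local_form g v.
Proof.
rewrite form_sum local_formE mulr_sumr; apply: eq_bigr => s _.
rewrite mulr_sumr; apply: eq_bigr => s' _; rewrite mulrCA; congr (_ * _).
transitivity (\sum_u (\sum_j wt j * zpow (z j) (cat s u) * beta j)^* * v (cat s' u)).
  under eq_bigr do rewrite /partial_amplitude mulr_sumr.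
  rewrite exchange_big; apply: eq_bigr => u _ /=; rewrite rmorph_sum mulr_suml.
  by apply: eq_bigr => j _; rewrite zpow_catw !rmorphM /= wt_conj; ring.
rewrite mulr_sumr; apply: eq_bigr => u _; rewrite sum_amplitude rmorphM /= conjC_nat; ring.
Qed.

(** Since <z^k|v_z> is the amplitude, this is |z|^(2k) r_z, with r_z the component of v_z orthogonal
    to z^k; the scaling avoids a division. *)
Definition residual j (s : Wk) := sqnorm (z j) ^+ k * vz j s - beta j * zpow (z j) s.

Lemma sum_residual g :
  \sum_j wt j / sqnorm (z j) ^+ k * form g (residual j) (residual j) =
  (rising (m - k + #|A|) k * (m - k)`!)%:R * local_form g v
  - 2 * m`!%:R * local_form g v + mp_form g.
Proof.
transitivity (\sum_j wt j * sqnorm (z j) ^+ k * form g (vz j) (vz j)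
  - \sum_j wt j * beta j * form g (vz j) (@zpow C A k (z j))
  - \sum_j wt j * (beta j)^* * form g (@zpow C A k (z j)) (vz j) + mp_form g); last first.
  by rewrite sum_form_vz_vz sum_form_vz_z sum_form_z_vz; ring.
rewrite -!sumrB -big_split; apply: eq_bigr => j _ /=.
rewrite form_comb rmorphXn /= sqnorm_conj.
(* A node z_j = 0 contributes zero on both sides: as k > 0, the powers of the norm and the vector
   z^k vanish, and the inverse of 0 is 0. *)
have [N0|N0] := eqVneq (sqnorm (z j)) 0; last first.
  by field; rewrite expf_neq0.
have zp0 : form g (vz j) (@zpow C A k (z j)) = 0.
  by rewrite /form big1 // => s _; rewrite big1 // => s' _; rewrite zpow0 // mulr0.
have zp0' : form g (@zpow C A k (z j)) (vz j) = 0.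
  by rewrite /form big1 // => s _; rewrite big1 // => s' _; rewrite zpow0 // conjC0 !mul0r.
by rewrite zp0 zp0' N0 expr0n (gtn_eqF k_gt0) mulr0n invr0; ring.
Qed.

Lemma local_form_id : local_form (@kid Wk) v = \sum_w (v w)^* * v w.
Proof.
rewrite (sum_catw hkm) exchange_big; apply: eq_bigr => u _ /=.
by rewrite form_id.
Qed.

Lemma sum_amplitude_sq :
  \sum_j wt j * ((beta j)^* * beta j) = m`!%:R * \sum_w (v w)^* * v w.
Proof.
rewrite mulr_sumr.
transitivity (\sum_w (v w)^* * \sum_j wt j * zpow (z j) w * beta j).
  under [in RHS]eq_bigr do rewrite mulr_sumr.
  rewrite exchange_big; apply: eq_bigr => j _ /=.
  rewrite {1}/amplitude rmorph_sum mulr_suml mulr_sumr; apply: eq_bigr => w _.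
  by rewrite rmorphM /= conjCK; ring.
by apply: eq_bigr => w _; rewrite sum_amplitude; ring.
Qed.

Lemma amplitude0 j : sqnorm (z j) = 0 -> beta j = 0.
Proof.
move=> N0; rewrite /amplitude big1 // => w _.
by rewrite zpow0 ?conjC0 ?mul0r // (leq_trans k_gt0).
Qed.

Lemma mp_form_id : mp_form (@kid Wk) = m`!%:R * \sum_w (v w)^* * v w.
Proof.
rewrite -sum_amplitude_sq; apply: eq_bigr => j _; rewrite form_id.
under [X in X / _]eq_bigr do rewrite mulrC.
rewrite zpow_norm; have [N0|N0] := eqVneq (sqnorm (z j)) 0.
  by rewrite amplitude0 // !(mulr0, mul0r).
by rewrite divff ?expf_neq0 // mulr1.
Qed.

Variable g : Wk -> Wk -> C.
Hypothesis g_effect : forall x, 0 <= form g x x <= \sum_s (x s)^* * x s.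

Let normv := \sum_w (v w)^* * v w.

(** Each bound compares g termwise with 0 and with the identity kernel, for which the same sums are
    known in closed form. The last one is the inequality for the residuals multiplied by m!. *)
Lemma de_finetti_bounds :
  [/\ 0 <= local_form g v <= normv, 0 <= mp_form g <= m`!%:R * normv &
  0 <= (rising (m - k + #|A|) k * (m - k)`!)%:R * local_form g v
     - 2 * m`!%:R * local_form g v + mp_form g
    <= ((rising (m - k + #|A|) k * (m - k)`!)%:R - m`!%:R) * normv].
Proof.
have [wt0 _] := dz; have N0 j : 0 <= sqnorm (z j) ^+ k by rewrite exprn_ge0 ?sqnorm_ge0.
have b0 j : 0 <= (beta j)^* * beta j by rewrite mulrC -normCK exprn_ge0.
split.
- rewrite /normv -local_form_id; apply/andP; split.
    by apply: sumr_ge0 => u _; case/andP: (g_effect (fun s => v (cat s u))).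
  by apply: ler_sum => u _; rewrite form_id; case/andP: (g_effect (fun s => v (cat s u))).
- rewrite /normv -mp_form_id; apply/andP; split.
    apply: sumr_ge0 => j _; apply: mulr_ge0; first exact: mulr_ge0.
    by apply: divr_ge0 => //; case/andP: (g_effect (zpow (z j) (n := k))).
  apply: ler_sum => j _; apply: ler_wpM2l; first exact: mulr_ge0.
  apply: ler_wpM2r; first by rewrite invr_ge0.
  by rewrite form_id; case/andP: (g_effect (zpow (z j) (n := k))).
- have -> : ((rising (m - k + #|A|) k * (m - k)`!)%:R - m`!%:R) * normv =
    \sum_j wt j / sqnorm (z j) ^+ k * form (@kid Wk) (residual j) (residual j).
    by rewrite sum_residual local_form_id mp_form_id -/normv; ring.
  rewrite -sum_residual; apply/andP; split.
    apply: sumr_ge0 => j _; apply: mulr_ge0; first exact: divr_ge0.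
    by case/andP: (g_effect (residual j)).
  apply: ler_sum => j _; apply: ler_wpM2l; first by rewrite mulr_ge0 ?invr_ge0.
  by rewrite form_id; case/andP: (g_effect (residual j)).
Qed.
End DeFinetti.

(** * From the ratio of dimensions to the constant 2 k D / m *)

Section RisingBound.

Lemma risingSr a k : rising a k.+1 = (rising a k * (a + k))%N.
Proof. by rewrite /rising big_ord_recr. Qed.

Lemma rising_shift a k : (rising a.+1 k * a = rising a k * (a + k))%N.
Proof.
elim: k => [|k IH]; first by rewrite /rising !big_ord0 addn0.
by rewrite !risingSr mulnAC IH; lia.
Qed.

Lemma rising_fact l k : (rising l.+1 k * l`! = (l + k)`!)%N.
Proof.
elim: k => [|k IH]; first by rewrite /rising big_ord0 addn0 mul1n.
by rewrite risingSr mulnAC IH addnS factS addSn mulnC.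
Qed.

(* For dimension D + 1, m! / (rising (m - k + D.+1) k * (m - k)!) is the ratio r
   of the dimensions of the symmetric subspaces on m - k and on m systems. *)
Lemma dimension_ratio D k m : (k <= m)%N ->
  (m * (rising (m - k + D.+1) k * (m - k)`!) <=
   m * m`! + D * k * (rising (m - k + D.+1) k * (m - k)`!))%N /\
  (m`! <= rising (m - k + D.+1) k * (m - k)`!)%N.
Proof.
move=> km; elim: D => [|D [IH1 IH2]].
  by rewrite addn1 rising_fact subnK // mul0n addn0.
have := rising_shift (m - k + D.+1) k; rewrite -addnS.
set F' := rising (m - k + D.+2) k; set F := rising _ k in IH1 IH2 *.
have -> : (m - k + D.+1 + k = m + D.+1)%N by lia.
move: (m - k)`! IH1 IH2 => c IH1 IH2 e.
(* Passing from D to D + 1 multiplies F c by (m + D + 1) / (m + D + 1 - k); the equation is stated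
   without subtraction. *)
have e' : (F' * c * (m + D.+1) = F * c * (m + D.+1) + k * (F' * c))%N.
  by have -> : (m + D.+1 = (m - k + D.+1) + k)%N; [lia | nia].
move: (F' * c)%N (F * c)%N e' IH1 IH2 => G' G e' IH1 IH2.
have GG : (G <= G')%N by nia.
by split; nia.
Qed.

(** For m this large the term D k f is at most m f / 2, so f <= 2 mu; putting this back into the
    term D k f gives the bound. *)
Lemma ratio_gap D k m f mu :
  (2 * k * D.+1 < m -> m * f <= m * mu + D * k * f -> m * (f - mu) <= 2 * k * D.+1 * mu)%N.
Proof.
move=> km f1; have xf : (2 * (D * k * f) <= m * f)%N.
  by rewrite mulnA leq_mul2r; apply/orP; right; lia.
have f3 : (f <= 2 * mu)%N by rewrite -(@leq_pmul2l m) ?(leq_trans _ km) //; lia.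
have {xf} := leq_mul (leqnn (D * k)) f3.
by rewrite mulnBr leq_subLR; lia.
Qed.

Lemma effect_bound (R : realFieldType) D k m (a M V : R) :
  (0 < D)%N -> (0 < k)%N -> (k <= m)%N ->
  let f := (rising (m - k + D) k * (m - k)`!)%N in
  0 <= a <= V -> 0 <= M <= m`!%:R * V ->
  0 <= f%:R * a - 2 * m`!%:R * a + M <= (f%:R - m`!%:R) * V ->
  `|a - M / m`!%:R| <= (2 * k * D)%:R / m%:R * V.
Proof.
case: D => // D _ k0 km f /andP[a0 aV] /andP[M0 MV] /andP[Q0 QV].
have [] := dimension_ratio D km; rewrite -/f => f1 f2.
have m0 : 0 < m%:R :> R by rewrite ltr0n (leq_trans k0).
have mu0 : 0 < m`!%:R :> R by rewrite ltr0n fact_gt0.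
have V0 : 0 <= V by apply: le_trans a0 aV.
pose x := M / m`!%:R.
have xE : M = m`!%:R * x by rewrite /x mulrC divfK // gt_eqF.
rewrite -/x; have x0 : 0 <= x by rewrite divr_ge0 // ltW.
have xV : x <= V by rewrite -(ler_pM2l mu0) -xE.
have ax : `|a - x| <= V by rewrite ler_norml; lra.
(* For small m the factor in front of V is at least 1, and |a - x| <= V is enough. *)
case: (leqP m (2 * k * D.+1)) => [mk|mk].
  apply: le_trans ax _; rewrite ler_peMl // ler_pdivlMr // mul1r ler_nat //.
have fle := ratio_gap mk f1.
(* With Q the quantity bounded in the last hypothesis, m! (a - x) = (f - m!) a - Q, a difference of
   two numbers in [0, (f - m!) V]. *)
have : `|m`!%:R * (a - x)| <= (f%:R - m`!%:R) * V.
  have ff : 0 <= f%:R - m`!%:R :> R by rewrite subr_ge0 ler_nat.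
  have := ler_wpM2l ff aV; have := mulr_ge0 ff a0.
  move: Q0 QV; rewrite xE ler_norml.
  set F := f%:R; set mu := m`!%:R; move=> q1 q2 q3 q4; apply/andP; split; lra.
rewrite normrM (gtr0_norm mu0) => H.
rewrite -(ler_pM2l mu0); apply: le_trans H _.
rewrite mulrA ler_wpM2r // mulrA ler_pdivlMr // -natrB // -!natrM ler_nat.
by rewrite mulnC (mulnC m`!).
Qed.
End RisingBound.

(** * Positive square roots and their symmetries *)

Section KernelSqrt.
Variable C : numClosedFieldType.

Definition sqrt_diag N (A : 'M[C]_N) : 'M[C]_N :=
  diag_mx (\row_j sqrtC (spectral_diag A 0 j)).

Definition psd_sqrt N (A : 'M[C]_N) : 'M[C]_N :=
  (spectralmx A)^t* *m sqrt_diag A *m spectralmx A.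

Lemma spectral_eq N (A : 'M[C]_N) : psd A ->
  A = (spectralmx A)^t* *m diag_mx (spectral_diag A) *m spectralmx A.
Proof.
move=> /psd_normal /orthomx_spectralP {1}->.
by rewrite invmx_unitary // spectral_unitarymx.
Qed.

Lemma spectralmxVK N (A : 'M[C]_N) :
  spectralmx A *m (spectralmx A)^t* = 1%:M /\ (spectralmx A)^t* *m spectralmx A = 1%:M.
Proof.
have := spectral_unitarymx A; have := spectral_unit A => U /unitarymxP e; split=> //.
by rewrite -(invmx_unitary (spectral_unitarymx A)) mulVmx.
Qed.

Lemma psd_sqrtP N (A : 'M[C]_N) : psd A -> psd_sqrt A *m (psd_sqrt A)^t* = A.
Proof.
move=> Ap; rewrite [RHS]spectral_eq // /psd_sqrt !trmxCM trmxCK !mulmxA.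
have [e _] := spectralmxVK A.
rewrite -(mulmxA _ (spectralmx A)) e mulmx1; congr (_ *m _).
rewrite -mulmxA; congr (_ *m _); apply/matrixP => i j.
rewrite mul_diag_mx !mxE.
rewrite (eq_sym j); case: eqP => [->|_]; last by rewrite !mulr0n conjC0 mulr0.
rewrite !mulr1n; have s0 := psd_spectral_diag_ge0 j Ap.
have /CrealP -> : sqrtC (spectral_diag A 0 j) \is Num.real by rewrite ger0_real // sqrtC_ge0.
by rewrite -expr2 sqrtCK.
Qed.

(** In an eigenbasis of A, a matrix commuting with A has nonzero entries only between equal
    eigenvalues, hence between equal square roots. *)
Lemma psd_sqrt_comm N (A X : 'M[C]_N) : psd A -> X *m A = A *m X ->
  X *m psd_sqrt A = psd_sqrt A *m X.
Proof.
move=> Ap XA; have eA := spectral_eq Ap; have [e1 e2] := spectralmxVK A.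
set P := spectralmx A in eA e1 e2; set d := spectral_diag A in eA.
pose Y := P *m X *m P^t*.
have XE : X = P^t* *m Y *m P by rewrite /Y !mulmxA e2 mul1mx -mulmxA e2 mulmx1.
have YD : Y *m diag_mx d = diag_mx d *m Y.
  have eD : diag_mx d = P *m A *m P^t*.
    by rewrite eA !mulmxA e1 mul1mx -mulmxA e1 mulmx1.
  have h (Z W : 'M[C]_N) : P *m Z *m P^t* *m (P *m W *m P^t*) = P *m (Z *m W) *m P^t*.
    by rewrite !mulmxA -(mulmxA _ (P^t*) P) e2 mulmx1.
  by rewrite eD /Y !h XA.
clearbody Y.
have YS : Y *m sqrt_diag A = sqrt_diag A *m Y.
  apply/matrixP => i j; move/matrixP: YD => /(_ i j).
  rewrite !mul_mx_diag !mul_diag_mx !mxE -/d => eY.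
  have [->|Y0] := eqVneq (Y i j) 0; first by rewrite mul0r mulr0.
  by move: eY; rewrite [RHS]mulrC => /(mulfI Y0) ->; rewrite mulrC.
have h (Z W : 'M[C]_N) : P^t* *m Z *m P *m (P^t* *m W *m P) = P^t* *m (Z *m W) *m P.
  by rewrite !mulmxA -(mulmxA _ P (P^t*)) e1 mulmx1.
by rewrite {1 2}XE /psd_sqrt -/P !h YS.
Qed.

(** The positive square root, unlike a general factor of K, inherits the symmetries: a permutation
    preserving K is a matrix commuting with K, hence with its root. *)
Lemma psd_kernel_sqrt (I : finType) (K : I -> I -> C) :
  (forall x, 0 <= form K x x) ->
  exists B : I -> I -> C, (forall i j, K i j = \sum_l B i l * (B j l)^*) /\
    forall s : {perm I}, (forall i j, K (s i) (s j) = K i j) ->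
      forall i j, B (s i) (s j) = B i j.
Proof.
move=> K0; pose A : 'M[C]_#|I| := \matrix_(a, b) K (enum_val a) (enum_val b).
have sumI (T : nmodType) (F : I -> T) : \sum_i F i = \sum_(a < #|I|) F (enum_val a).
  by rewrite (reindex (@enum_val I predT)) //; apply: onW_bij; apply: enum_val_bij.
have Ap : psd A.
  move=> v; rewrite sesqE; have := K0 (fun i => v (enum_rank i) 0).
  rewrite /form sumI; under eq_bigr do rewrite sumI.
  under eq_bigr do under eq_bigr do rewrite !enum_valK.
  by under [X in _ -> _ <= X]eq_bigr do under eq_bigr do rewrite mxE.
pose B i j := psd_sqrt A (enum_rank i) (enum_rank j).
exists B; split=> [i j|s Ks i j].
  have /matrixP/(_ (enum_rank i) (enum_rank j)) := psd_sqrtP Ap.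
  rewrite [in RHS]mxE !enum_rankK => <-; rewrite mxE sumI; apply: eq_bigr => a _.
  by rewrite mxtrC /B enum_valK.
pose X : 'M[C]_#|I| := \matrix_(a, b) (s (enum_val a) == enum_val b)%:R.
have Xl (Z : 'M[C]_#|I|) a b : (X *m Z) a b = Z (enum_rank (s (enum_val a))) b.
  rewrite mxE (bigD1 (enum_rank (s (enum_val a)))) //= mxE enum_rankK eqxx mul1r.
  rewrite big1 ?addr0 // => c ca; rewrite mxE (_ : (_ == _) = false) ?mul0r //.
  by apply: contraNF ca => /eqP ->; rewrite enum_valK.
have Xr (Z : 'M[C]_#|I|) a b : (Z *m X) a b = Z a (enum_rank (s^-1%g (enum_val b))).
  rewrite mxE (bigD1 (enum_rank (s^-1%g (enum_val b)))) //= mxE enum_rankK permKV eqxx mulr1.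
  rewrite big1 ?addr0 // => c ca; rewrite mxE (_ : (_ == _) = false) ?mulr0 //.
  by apply: contraNF ca => /eqP <-; rewrite permK enum_valK.
have /(psd_sqrt_comm Ap)/matrixP/(_ (enum_rank i) (enum_rank (s j))) : X *m A = A *m X.
  apply/matrixP => a b; rewrite Xl Xr !mxE !enum_rankK.
  by rewrite -(Ks (enum_val a)) permKV.
by rewrite Xl Xr !enum_rankK permK.
Qed.
End KernelSqrt.

(** * Measure-and-prepare protocols *)

Section MeasurePrepare.
Variable R : realType.
Local Notation C := R[i].

Lemma psdmx_factor N (A : 'M[C]_N) : psdmx A -> exists B : 'M[C]_N, A = B *m B^t*.
Proof. by move=> Ap; exists (psd_sqrt A); rewrite psd_sqrtP. Qed.

Lemma psdmx_gram N M (B : 'M[C]_(N, M)) : psdmx (B *m B^t*).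
Proof.
move=> v; have -> : v^t* *m (B *m B^t*) *m v = (B^t* *m v)^t* *m (B^t* *m v).
  by rewrite trmxCM trmxCK !mulmxA.
by rewrite mxE; apply: sumr_ge0 => i _; rewrite mxtrC mulrC -normCK exprn_ge0.
Qed.

Lemma psdmx_sum N (I : finType) (P : pred I) (A : I -> 'M[C]_N) :
  (forall i, psdmx (A i)) -> psdmx (\sum_(i | P i) A i).
Proof.
move=> Ap v; rewrite mulmx_sumr mulmx_suml summxE.
by apply: sumr_ge0 => i _; apply: Ap.
Qed.

Lemma psdmxZ N c (A : 'M[C]_N) : 0 <= c -> psdmx A -> psdmx (c *: A).
Proof.
by move=> c0 Ap v; rewrite -scalemxAr -scalemxAl mxE mulr_ge0 //; apply: Ap.
Qed.

Lemma trace_gram N M (B : 'M[C]_(N, M)) (A : 'M[C]_N) :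
  \tr (B *m B^t* *m A) = \sum_b ((col b B)^t* *m A *m col b B) 0 0.
Proof.
rewrite -mulmxA mxtrace_mulC; apply: eq_bigr => b _.
rewrite !mxE; apply: eq_bigr => i _; rewrite [col b B i 0]mxE; congr (_ * _).
by rewrite !mxE; apply: eq_bigr => j _; rewrite !mxE.
Qed.

Lemma psdmx_trace_ge0 N (A B : 'M[C]_N) : psdmx A -> psdmx B -> 0 <= \tr (A *m B).
Proof.
move=> /psdmx_factor[S ->] Bp; rewrite trace_gram.
by apply: sumr_ge0 => b _; apply: Bp.
Qed.

Lemma trace_sum N (I : finType) (P : pred I) (A : I -> 'M[C]_N) :
  \tr (\sum_(i | P i) A i) = \sum_(i | P i) \tr (A i).
Proof. exact: (raddf_sum (@mxtrace C N)). Qed.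

Lemma sesq_mxblock r N (F : 'I_r -> 'I_r -> 'M[C]_N) (v : 'I_r -> 'cV[C]_N) :
  ((\mxcol_i v i)^t* *m (\mxblock_(i, j) F i j) *m (\mxcol_i v i)) 0 0 =
  \sum_i \sum_j ((v i)^t* *m F i j *m v j) 0 0.
Proof.
have -> : (\mxcol_i v i)^t* = \mxrow_i (v i)^t*.
  by apply/matrixP => i j; rewrite !mxE.
rewrite mul_mxrow_mxblock mul_mxrow_mxcol summxE exchange_big /=.
apply: eq_bigr => j _; rewrite mulmx_suml summxE.
by apply: eq_bigr => i _.
Qed.

(** After factoring every effect and every state as a Gram matrix, the form on the output blocks is
    a sum of forms of the input block matrix at the vectors with blocks [gam c i *: col b B]. *)
Lemma measure_prepare_cp N M (J : finType) (E : J -> 'M[C]_N) (sg : J -> 'M[C]_M) :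
  (forall j, psdmx (E j)) -> (forall j, psdmx (sg j)) ->
  completely_positive (fun rho => \sum_j \tr (E j *m rho) *: sg j).
Proof.
move=> Ep sp r A Ap v; rewrite -[v]submxcolK sesq_mxblock.
set w := submxcol v.
have -> : \sum_i \sum_j (((w i)^t* *m (\sum_y \tr (E y *m A i j) *: sg y)) *m w j) 0 0 =
    \sum_y \sum_i \sum_j \tr (E y *m A i j) * ((w i)^t* *m sg y *m w j) 0 0.
  transitivity (\sum_i \sum_j \sum_y \tr (E y *m A i j) * ((w i)^t* *m sg y *m w j) 0 0).
    apply: eq_bigr => i _; apply: eq_bigr => j _.
    rewrite mulmx_sumr mulmx_suml summxE; apply: eq_bigr => y _.
    by rewrite -scalemxAr -scalemxAl mxE.
  rewrite [RHS]exchange_big; apply: eq_bigr => i _ /=.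
  by rewrite [RHS]exchange_big.
apply: sumr_ge0 => y _.
have [B ->] := psdmx_factor (Ep y); have [S ->] := psdmx_factor (sp y).
pose gam c i : C := (S^t* *m w i) c 0.
have -> : \sum_i \sum_j \tr (B *m B^t* *m A i j) * ((w i)^t* *m (S *m S^t*) *m w j) 0 0 =
    \sum_b \sum_c \sum_i \sum_j ((gam c i *: col b B)^t* *m A i j *m (gam c j *: col b B)) 0 0.
  transitivity (\sum_i \sum_j \sum_b \sum_c
      ((gam c i *: col b B)^t* *m A i j *m (gam c j *: col b B)) 0 0).
    apply: eq_bigr => i _; apply: eq_bigr => j _.
    have -> : ((w i)^t* *m (S *m S^t*) *m w j) 0 0 = \sum_c (gam c i)^* * gam c j.
      have -> : (w i)^t* *m (S *m S^t*) *m w j = (S^t* *m w i)^t* *m (S^t* *m w j).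
        by rewrite trmxCM trmxCK !mulmxA.
      by rewrite mxE; apply: eq_bigr => c _; rewrite mxtrC.
    rewrite trace_gram mulr_suml; apply: eq_bigr => b _.
    rewrite mulr_sumr; apply: eq_bigr => c _.
    rewrite trmxCZ -!scalemxAl -scalemxAr scalerA.
    have mxZ a (Z : 'M[C]_1) : (a *: Z) 0 0 = a * Z 0 0 by rewrite mxE.
    by rewrite mxZ mulrC.
  transitivity (\sum_i \sum_b \sum_c \sum_j
      ((gam c i *: col b B)^t* *m A i j *m (gam c j *: col b B)) 0 0).
    apply: eq_bigr => i _; rewrite exchange_big; apply: eq_bigr => b _ /=.
    by rewrite exchange_big.
  rewrite exchange_big; apply: eq_bigr => b _ /=.
  by rewrite exchange_big.
apply: sumr_ge0 => b _; apply: sumr_ge0 => c _.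
by rewrite -sesq_mxblock; apply: Ap.
Qed.

Lemma measure_prepare_quantum_operation N M (J : finType) (E : J -> 'M[C]_N)
    (sg : J -> 'M[C]_M) (Phi : {linear 'M[C]_N -> 'M[C]_M}) :
  (forall j, psdmx (E j)) -> psdmx (1%:M - \sum_j E j) -> (forall j, is_state (sg j)) ->
  (forall rho, Phi rho = \sum_j \tr (E j *m rho) *: sg j) -> quantum_operation Phi.
Proof.
move=> Ep E1 sp PhiE; split.
  have -> : (Phi : 'M[C]_N -> 'M[C]_M) = fun rho => \sum_j \tr (E j *m rho) *: sg j.
    by apply/funext.
  by apply: measure_prepare_cp => // j; case: (sp j).
move=> rho rp; rewrite PhiE raddf_sum /=.
rewrite (eq_bigr (fun j => \tr (E j *m rho))); last first.
  by move=> j _; rewrite mxtraceZ; case: (sp j) => _ ->; rewrite mulr1.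
have := psdmx_trace_ge0 E1 rp.
have -> : \tr ((1%:M - \sum_j E j) *m rho) = \tr rho - \sum_j \tr (E j *m rho).
  by rewrite mulmxBl mul1mx mulmx_suml (raddfB (@mxtrace C N)) /= trace_sum.
by rewrite subr_ge0.
Qed.

Lemma ge0_Re (z : C) : 0 <= z -> z = ((complex.Re z)%:C)%C.
Proof. by move=> /ger0_real /RRe_real. Qed.

Lemma Re_ge0 (z : C) : 0 <= z -> 0 <= complex.Re z.
Proof. by rewrite lecE => /andP[]. Qed.

Lemma Re_sum (I : Type) (r : seq I) (P : pred I) (F : I -> C) :
  complex.Re (\sum_(i <- r | P i) F i) = \sum_(i <- r | P i) complex.Re (F i).
Proof. by apply: (big_morph (@complex.Re R)) => // -[? ?] [? ?]. Qed.

(* Finitely many outcomes are encoded as an initial segment of the discrete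
   space nat. *)
Section FiniteOutcomes.
Variables (q : nat) (p : 'I_q -> R).

(** The absolute value makes the weight nonnegative for every p and disappears under [p_ge0];
    indices from q on get weight 0. *)
Definition weighted_dirac (i : nat) : {measure set nat -> \bar R} :=
  mscale (NngNum (normr_ge0 (if insub i is Some i' then p i' else 0))) (@dirac _ nat i R).

Definition finite_measure_nat : {measure set nat -> \bar R} := msum weighted_dirac q.

Hypothesis p_ge0 : forall i, 0 <= p i.

Lemma finite_measure_natE (A : set nat) :
  finite_measure_nat A = (\sum_(i < q) p i * (val i \in A)%:R)%:E.
Proof.
rewrite /finite_measure_nat /= /msum -sumEFin; apply: eq_bigr => i _.
by rewrite /weighted_dirac /= /mscale /= valK diracE EFinM ger0_norm.
Qed.

Lemma ge0_integral_finite_measure_nat (f : nat -> \bar R) : (forall y, (0 <= f y)%E) ->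
  (\int[finite_measure_nat]_(y in setT) f y = \sum_(i < q) (p i)%:E * f i)%E.
Proof.
move=> f0; rewrite /finite_measure_nat ge0_integral_measure_sum //.
apply: eq_bigr => i _.
rewrite /weighted_dirac ge0_integral_mscale // integral_dirac // diracT mul1e /= valK.
by rewrite ger0_norm.
Qed.

Lemma Rintegral_finite_measure_nat (f : nat -> R) :
  \int[finite_measure_nat]_(y in setT) f y = \sum_(i < q) p i * f i.
Proof.
rewrite /Rintegral integralE !ge0_integral_finite_measure_nat //.
under eq_bigr do rewrite funeposE -EFin_max -EFinM.
under [X in (_ - X)%E]eq_bigr do rewrite funenegE -EFinN -EFin_max -EFinM.
rewrite !sumEFin -EFinB /= -sumrB; apply: eq_bigr => i _; rewrite -mulrBr; congr (_ * _).
by have [h|h] := lerP (f i) 0; have [h'|h'] := lerP (- f i) 0; lra.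
Qed.
End FiniteOutcomes.

Lemma pm_protocol_finite N M q (E : 'I_q -> 'M[C]_N) (sg : 'I_q -> 'M[C]_M) (s0 : 'M[C]_M)
    (Phi : {linear 'M[C]_N -> 'M[C]_M}) :
  (forall j, psdmx (E j)) -> psdmx (1%:M - \sum_j E j) ->
  (forall j, is_state (sg j)) -> is_state s0 ->
  (forall rho, Phi rho = \sum_j \tr (E j *m rho) *: sg j) -> pm_protocol Phi.
Proof.
move=> Ep E1 sp s0p PhiE; split; first exact: measure_prepare_quantum_operation PhiE.
pose EA (A : set nat) : 'M[C]_N := \sum_(i < q | val i \in A) E i.
(* Outcomes from q on carry no mass; they are sent to [s0] because [sigma] has to be a state
   everywhere. *)
pose sigma (y : nat) := if insub y is Some i then sg i else s0.
have outE rho : psdmx rho ->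
    outcome_measure EA rho (finite_measure_nat (fun i => complex.Re (\tr (E i *m rho)))).
  move=> rp A _; rewrite finite_measure_natE; last first.
    by move=> i; apply/Re_ge0/psdmx_trace_ge0.
  congr (_%:E); rewrite /EA mulmx_suml trace_sum Re_sum [RHS]big_mkcond /=.
  by apply: eq_bigr => i _; case: ifP; rewrite ?mulr1 ?mulr0.
exists _, nat, EA, sigma; split.
- split=> [A _|rho rp|]; first exact: psdmx_sum.
    by eexists; apply: outE.
  by rewrite /EA (eq_bigl xpredT) // => i; exact: in_setT.
- by move=> y; rewrite /sigma; case: insubP.
- by [].
move=> rho mu rp mu_out; rewrite PhiE.
have E0 i := psdmx_trace_ge0 (Ep i) rp.
have mu_eq f : \int[mu]_(y in setT) f y =
    \sum_(i < q) complex.Re (\tr (E i *m rho)) * f i.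
  rewrite -Rintegral_finite_measure_nat; last by move=> i; apply: Re_ge0.
  congr fine; apply: eq_measure_integral => A mA _.
  by rewrite mu_out // -outE.
apply/matrixP => a b; rewrite !mxE !mu_eq summxE.
rewrite [RHS]complexE /= !rmorph_sum /= mulr_sumr -big_split /=; apply: eq_bigr => i _.
rewrite mxE /sigma valK [sg i a b]complexE [\tr _ in LHS]ge0_Re // !rmorphM /=.
by ring.
Qed.
End MeasurePrepare.

(** * Words of pairs: each system C^d comes with an ancilla C^d *)

Section PairWords.
Variables (A1 A2 : finType).

Definition pairw n (h : {ffun 'I_n -> A1}) (x : {ffun 'I_n -> A2}) :
  {ffun 'I_n -> A1 * A2} := [ffun i => (h i, x i)].
Definition fstw n (w : {ffun 'I_n -> A1 * A2}) : {ffun 'I_n -> A1} := [ffun i => (w i).1].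
Definition sndw n (w : {ffun 'I_n -> A1 * A2}) : {ffun 'I_n -> A2} := [ffun i => (w i).2].

Lemma fstwK n h x : fstw (@pairw n h x) = h.
Proof. by apply/ffunP => i; rewrite !ffunE. Qed.
Lemma sndwK n h x : sndw (@pairw n h x) = x.
Proof. by apply/ffunP => i; rewrite !ffunE. Qed.
Lemma pairwK n w : @pairw n (fstw w) (sndw w) = w.
Proof. by apply/ffunP => i; rewrite !ffunE -surjective_pairing. Qed.

Lemma sum_pairw (T : nmodType) n (F : {ffun 'I_n -> A1 * A2} -> T) :
  \sum_w F w = \sum_h \sum_x F (pairw h x).
Proof.
rewrite pair_bigA /=.
rewrite (reindex (fun p : {ffun 'I_n -> A1} * {ffun 'I_n -> A2} => pairw p.1 p.2)) //=.
exists (fun w => (fstw w, sndw w)) => [[h x] _|w _] /=; first by rewrite fstwK sndwK.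
by rewrite pairwK.
Qed.

Lemma sum_pair (T : nmodType) (I1 I2 : finType) (F : I1 * I2 -> T) :
  \sum_p F p = \sum_i \sum_j F (i, j).
Proof. by rewrite pair_bigA; apply: eq_bigr => -[]. Qed.

Lemma catw_pairw k m (hkm : (k <= m)%N) s x u y :
  catw hkm (@pairw k s x) (@pairw (m - k) u y) = pairw (catw hkm s u) (catw hkm x y).
Proof. by apply/ffunP => i; rewrite !ffunE; case: fintype.split => j; rewrite !ffunE. Qed.

Lemma fstw_wperm m (s : 'S_m) w : fstw (wperm s w) = wperm s (fstw w).
Proof. by apply/ffunP => i; rewrite !ffunE. Qed.
Lemma sndw_wperm m (s : 'S_m) w : sndw (wperm s w) = wperm s (sndw w).
Proof. by apply/ffunP => i; rewrite !ffunE. Qed.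
End PairWords.

(** * Tracing out the ancillas, and overlaps as expectations of an effect *)

Section ReducedOperators.
Variable R : realType.
Local Notation C := R[i].
Variable d : nat.
Local Notation A := ('I_d * 'I_d)%type.

(** The partial trace of |x><x| over the second components of all letters. *)
Definition reduced n (x : {ffun 'I_n -> A} -> C) : 'M[C]_(tdim d n) :=
  \matrix_(a, b) \sum_y x (pairw (word a) y) * (x (pairw (word b) y))^*.

Lemma sum_word n (T : nmodType) (F : {ffun 'I_n -> 'I_d} -> T) :
  \sum_h F h = \sum_(a < tdim d n) F (word a).
Proof. by rewrite (reindex (@word d n)) //; apply/onW_bij/enum_val_bij. Qed.

Lemma reduced_psd n (x : {ffun 'I_n -> A} -> C) : psdmx (reduced x).
Proof.
have -> : reduced x = \sum_y (\col_a x (pairw (word a) y)) *m (\col_a x (pairw (word a) y))^t*.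
  apply/matrixP => a b; rewrite mxE summxE; apply: eq_bigr => y _.
  by rewrite mxE big_ord1 mxtrC !mxE.
by apply: psdmx_sum => y; apply: psdmx_gram.
Qed.

Lemma reduced_trace n (x : {ffun 'I_n -> A} -> C) : \tr (reduced x) = \sum_w (x w)^* * x w.
Proof.
rewrite sum_pairw sum_word; apply: eq_bigr => a _; rewrite mxE.
by apply: eq_bigr => y _; rewrite mulrC.
Qed.

Lemma tens_ketE n (v : 'cV[C]_d) a : tens_ket (fun=> v) a 0 = zpow (v^~ 0) (@word d n a).
Proof. by rewrite mxE. Qed.

Lemma unit_ket_sqnorm (v : 'cV[C]_d) : unit_ket v -> sqnorm (v^~ 0) = 1.
Proof.
by rewrite /unit_ket mxE => <-; apply: eq_bigr => i _; rewrite mxtrC mulrC.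
Qed.

Lemma input_state_ketbra n (v : 'cV[C]_d) : input_state n v = ketbra (tens_ket (fun=> v)).
Proof.
apply/matrixP => a b; rewrite !mxE big_ord1 mxtrC !tens_ketE /zpow rmorph_prod -big_split.
by apply: eq_bigr => i _; rewrite mxE big_ord1 mxtrC.
Qed.

(** The kernel of the effect that projects the k systems onto v^k and is the identity on their
    ancillas. *)
Definition ket_effect k (v : 'cV[C]_d) (p q : {ffun 'I_k -> A}) : C :=
  (sndw p == sndw q)%:R * (zpow (v^~ 0) (fstw p) * (zpow (v^~ 0) (fstw q))^*).
Arguments ket_effect : clear implicits.

Lemma form_ket_effect k v x y :
  form (ket_effect k v) x y = \sum_c (\sum_s (x (pairw s c))^* * zpow (v^~ 0) s) *
                          (\sum_s (zpow (v^~ 0) s)^* * y (pairw s c)).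
Proof.
rewrite /form sum_pairw exchange_big; apply: eq_bigr => c _ /=.
rewrite mulr_suml; apply: eq_bigr => s _; rewrite sum_pairw mulr_sumr.
apply: eq_bigr => s' _; rewrite (bigD1 c) //= big1 ?addr0 => [|c' cc'].
  by rewrite /ket_effect !fstwK !sndwK eqxx mul1r; ring.
by rewrite /ket_effect !sndwK eq_sym (negbTE cc') !(mul0r, mulr0).
Qed.

Lemma ket_effect_bounds k v (x : {ffun 'I_k -> A} -> C) : unit_ket v ->
  0 <= form (ket_effect k v) x x <= \sum_s (x s)^* * x s.
Proof.
move=> v1; rewrite form_ket_effect.
pose c y := \sum_s (x (pairw s y))^* * zpow (v^~ 0) s.
have cE y : \sum_s (zpow (v^~ 0) s)^* * x (pairw s y) = (c y)^*.
  by rewrite rmorph_sum; apply: eq_bigr => s _; rewrite rmorphM /= conjCK mulrC.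
under eq_bigr do rewrite cE -/(c _).
rewrite sum_pairw exchange_big /=; apply/andP; split.
  by apply: sumr_ge0 => y _; rewrite -normCK exprn_ge0.
apply: ler_sum => y _.
(* [r] is the slice of x at y minus its component along the unit vector v^k; nonnegativity of its
   norm is Bessel's inequality. *)
pose r s := 1 * x (pairw s y) - (c y)^* * zpow (v^~ 0) s.
have r0 : 0 <= form (@kid C _) r r.
  by rewrite form_id; apply: sumr_ge0 => s _; rewrite mulrC -normCK exprn_ge0.
rewrite /r form_comb !form_id conjC1 conjCK -/(c y) in r0.
rewrite [X in _ - X + _](_ : _ = c y * (c y)^*) in r0; last by rewrite mulr1 cE.
rewrite [X in _ + X](_ : _ = c y * (c y)^*) in r0; last first.
  under eq_bigr do rewrite mulrC.
  by rewrite zpow_norm unit_ket_sqnorm // expr1n mulr1.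
by move: r0; rewrite !mul1r mulrC addrNK subr_ge0 mulrC.
Qed.

Variables (k m : nat) (hkm : (k <= m)%N).

Definition ket_overlap (v : 'cV[C]_d) (X : 'M[C]_(tdim d m)) : C :=
  let w : 'cV[C]_(tdim d k) := tens_ket (fun=> v) in
  (w^t* *m ptrace hkm X *m w) 0 0.

Lemma ket_overlapE v X : ket_overlap v X =
  \sum_s \sum_s' (zpow (v^~ 0) s)^* * zpow (v^~ 0) s' *
    \sum_u X (enum_rank (catw hkm s u)) (enum_rank (catw hkm s' u)).
Proof.
rewrite /ket_overlap sesqE sum_word; apply: eq_bigr => a _.
rewrite sum_word; apply: eq_bigr => b _.
by rewrite !tens_ketE mxE; ring.
Qed.

Lemma ket_overlap_sum v (I : finType) (c : I -> C) (X : I -> 'M[C]_(tdim d m)) :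
  ket_overlap v (\sum_i c i *: X i) = \sum_i c i * ket_overlap v (X i).
Proof.
rewrite ket_overlapE; under [RHS]eq_bigr do rewrite ket_overlapE mulr_sumr.
rewrite [RHS]exchange_big; apply: eq_bigr => s _ /=.
under [RHS]eq_bigr do rewrite mulr_sumr.
rewrite [RHS]exchange_big; apply: eq_bigr => s' _ /=.
under [RHS]eq_bigr do rewrite mulrCA.
rewrite -mulr_sumr; congr (_ * _).
under [RHS]eq_bigr do rewrite mulr_sumr.
rewrite [RHS]exchange_big; apply: eq_bigr => u _ /=.
by rewrite summxE; apply: eq_bigr => i _; rewrite mxE.
Qed.

(** The first k ancillas enter through the identity part of [ket_effect]; the last m - k systems and
    ancillas are the words summed over in [local_form]. *)
Lemma ket_overlap_reduced v (x : {ffun 'I_m -> A} -> C) :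
  ket_overlap v (reduced x) = local_form hkm (ket_effect k v) x.
Proof.
rewrite ket_overlapE /local_form sum_pairw.
transitivity (\sum_s \sum_s' \sum_u \sum_y2 \sum_y1 (zpow (v^~ 0) s)^* * zpow (v^~ 0) s' *
   (x (pairw (catw hkm s u) (catw hkm y1 y2)) * (x (pairw (catw hkm s' u) (catw hkm y1 y2)))^*)).
  apply: eq_bigr => s _; apply: eq_bigr => s' _; rewrite mulr_sumr; apply: eq_bigr => u _.
  rewrite mxE (sum_catw hkm) mulr_sumr [RHS]exchange_big; apply: eq_bigr => y1 _ /=.
  by rewrite mulr_sumr; apply: eq_bigr => y2 _; rewrite /word !enum_rankK.
under eq_bigr do rewrite exchange_big /=.
rewrite exchange_big; apply: eq_bigr => u _ /=.
under eq_bigr do rewrite exchange_big /=.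
rewrite exchange_big; apply: eq_bigr => y2 _ /=.
rewrite form_ket_effect; under eq_bigr do rewrite exchange_big /=.
rewrite exchange_big; apply: eq_bigr => y1 _ /=.
rewrite mulr_suml exchange_big; apply: eq_bigr => s' _ /=.
rewrite mulr_sumr; apply: eq_bigr => s _ /=.
by rewrite !catw_pairw; ring.
Qed.
End ReducedOperators.
Arguments ket_effect {R} d k v p q.

(** * Averaging a uniform bound over a prior *)

Section AverageBound.
Variable R : realType.

Lemma average_dist (X : choiceType) (p f g : X -> R) (c : R) : is_prior p ->
  (forall x, 0 <= f x <= 1) -> (forall x, 0 <= g x <= 1) ->
  (forall x, `|f x - g x| <= c) -> 0 <= c ->
  `|average p f - average p g| <= c.
Proof.
move=> [p0 p1] f01 g01 fgc c0.
(* X may be infinite; values in [0, 1] keep the weighted sums finite, so that [fine] loses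
   nothing. *)
have fin (h : X -> R) : (forall x, 0 <= h x <= 1) ->
    (\esum_(x in [set: X]) (p x * h x)%:E \is a fin_num)%E.
  move=> h01; rewrite ge0_fin_numE; last first.
    by apply: esum_ge0 => x _; rewrite lee_fin mulr_ge0 //; case/andP: (h01 x).
  apply: (@le_lt_trans _ _ 1%E); last by rewrite ltry.
  rewrite -p1; apply: le_esum => x _; rewrite lee_fin ler_piMr //.
  by case/andP: (h01 x).
have pc : (\esum_(x in [set: X]) (p x * c)%:E <= c%:E)%E.
  apply: ge_ereal_sup => _ [Y [Yfin _] <-].
  under eq_fsbigr do rewrite mulrC EFinM.
  rewrite -ge0_mule_fsumr; last by move=> x; rewrite lee_fin.
  rewrite -[leRHS]mule1; apply: lee_wpmul2l; first by rewrite lee_fin.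
  by rewrite -p1; apply: ereal_sup_ubound; exists Y.
have half (a b : X -> R) : (forall x, 0 <= a x <= 1) -> (forall x, 0 <= b x <= 1) ->
    (forall x, a x <= b x + c) -> average p a <= average p b + c.
  move=> a01 b01 abc; rewrite /average -lee_fin EFinD !fineK ?fin //.
  apply: (@le_trans _ _ (\esum_(x in [set: X]) ((p x * b x)%:E + (p x * c)%:E))%E).
    apply: le_esum => x _; rewrite -EFinD lee_fin -mulrDr; exact: ler_wpM2l.
  rewrite esumD; first exact: leeD2l.
  - by move=> x _; rewrite lee_fin mulr_ge0 //; case/andP: (b01 x).
  - by move=> x _; rewrite lee_fin mulr_ge0.
have h1 : average p f <= average p g + c.
  by apply: half => // x; have := fgc x; rewrite ler_norml => /andP[]; lra.
have h2 : average p g <= average p f + c.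
  by apply: half => // x; have := fgc x; rewrite ler_norml => /andP[]; lra.
by rewrite ler_norml; apply/andP; split; lra.
Qed.
End AverageBound.

(** * The Choi operator and a symmetric dilation *)

Section Choi.
Variable R : realType.
Local Notation C := R[i].
Variables (d m N : nat) (Phi : {linear 'M[C]_N -> 'M[C]_(tdim d m)}).
Hypothesis Phi_cp : completely_positive Phi.
Hypothesis Phi_inv : perm_invariant_output Phi.
Local Notation W := {ffun 'I_m -> 'I_d}.
Local Notation A := ('I_d * 'I_d)%type.

Definition choi (p q : 'I_N * W) : C :=
  Phi (delta_mx p.1 q.1) (enum_rank p.2) (enum_rank q.2).

(** Complete positivity is applied to the block matrix of all |i><j|, the projector, up to
    normalisation, onto the maximally entangled vector. *)
Lemma choi_psd x : 0 <= form choi x x.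
Proof.
have gram : \mxblock_(i < N, j < N) (delta_mx i j : 'M[C]_N) =
    (\mxcol_i (delta_mx i 0 : 'cV[C]_N)) *m (\mxcol_i (delta_mx i 0 : 'cV[C]_N))^t*.
  have -> : (\mxcol_i (delta_mx i 0 : 'cV[C]_N))^t* = \mxrow_i (delta_mx 0 i : 'rV[C]_N).
    apply/matrixP => a b; rewrite !mxE andbC /=.
    by case: (_ && _); rewrite ?conjC1 ?conjC0.
  rewrite mul_mxcol_mxrow; apply/eq_mxblockP => i j.
  by rewrite mul_delta_mx.
have := @Phi_cp N (fun i j => delta_mx i j).
rewrite gram => /(_ (psdmx_gram _)) H.
have := H (\mxcol_i \col_a x (i, word a)); rewrite sesq_mxblock.
congr (_ <= _); rewrite /form.
rewrite sum_pair; apply: eq_bigr => i _; rewrite sum_word [RHS]exchange_big /=.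
rewrite sum_pair; apply: eq_bigr => j _; rewrite sum_word sesqE exchange_big /=.
apply: eq_bigr => b _; apply: eq_bigr => a _.
by rewrite !mxE /choi /= /word !enum_valK.
Qed.

Lemma choi_wperm (s : 'S_m) i h j h' :
  choi (i, wperm s h) (j, wperm s h') = choi (i, h) (j, h').
Proof.
(* [perm_word] permutes positions by the inverse and [wperm] by s itself, hence the instance at the
   inverse of s. *)
have /matrixP/(_ (enum_rank h) (enum_rank h')) := Phi_inv s^-1%g (delta_mx i j).
rewrite mxE /choi /= => <-; rewrite /word !enum_rankK.
by congr (Phi _ (enum_rank _) (enum_rank _)); apply/ffunP => a; rewrite !ffunE invgK.
Qed.

Lemma ketbra_delta (x : 'cV[C]_N) :
  ketbra x = \sum_i \sum_j (x i 0 * (x j 0)^*) *: delta_mx i j.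
Proof.
rewrite [LHS]matrix_sum_delta; apply: eq_bigr => i _; apply: eq_bigr => j _.
by rewrite mxE big_ord1 mxtrC.
Qed.

(* The family B comes from the permutation-invariant square root of the Choi
   operator: it is a Stinespring dilation of Phi whose output, as a vector on
   m copies of C^d (x) C^d, is symmetric. *)
Lemma symmetric_dilation : exists B : 'I_N -> 'I_N -> {ffun 'I_m -> A} -> C,
  (forall i l, symmetric_fun (B i l)) /\
  forall x, Phi (ketbra x) = \sum_l reduced (fun w => \sum_i x i 0 * B i l w).
Proof.
have [B [KB Bs]] := psd_kernel_sqrt choi_psd.
(* The column index of the square root splits into a Kraus label l and a word whose letters become
   the ancillas. Invariance of the root under simultaneous permutation of row and column words is
   then symmetry in w. *)
exists (fun i l w => B (i, fstw w) (l, sndw w)); split=> [i l s w|x].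
  have inj : injective (fun p : 'I_N * W => (p.1, wperm s p.2)).
    move=> [a h] [b h'] /= [-> /ffunP e]; congr (_, _); apply/ffunP => c.
    by have := e (s^-1%g c); rewrite !ffunE permKV.
  rewrite fstw_wperm sndw_wperm -[RHS](Bs (perm inj)) ?permE //.
  by move=> [a h] [b h']; rewrite !permE /= choi_wperm.
apply/matrixP => a b; rewrite ketbra_delta linear_sum [LHS]summxE [RHS]summxE.
under eq_bigr do rewrite linear_sum summxE.
transitivity (\sum_i \sum_j \sum_l \sum_y (x i 0 * B (i, word a) (l, y)) *
   (x j 0 * B (j, word b) (l, y))^*).
  apply: eq_bigr => i _; apply: eq_bigr => j _.
  rewrite linearZ mxE /=.
  have -> : Phi (delta_mx i j) a b = choi (i, word a) (j, word b).
    by rewrite /choi /= /word !enum_valK.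
  rewrite KB sum_pair.
  rewrite mulr_sumr; apply: eq_bigr => l _; rewrite mulr_sumr; apply: eq_bigr => y _.
  by rewrite rmorphM /=; ring.
under eq_bigr do rewrite exchange_big /=.
rewrite exchange_big; apply: eq_bigr => l _ /=.
under eq_bigr do rewrite exchange_big /=.
rewrite exchange_big mxE; apply: eq_bigr => y _ /=.
rewrite fstwK fstwK sndwK sndwK rmorph_sum mulr_suml; apply: eq_bigr => i _.
by rewrite mulr_sumr.
Qed.
End Choi.

Section MPMap.
Variables (R : realType) (N M : nat) (J : finType).
Variables (E : J -> 'M[R[i]]_N) (sg : J -> 'M[R[i]]_M).

Definition mp_map (rho : 'M[R[i]]_N) : 'M[R[i]]_M := \sum_j \tr (E j *m rho) *: sg j.

Fact mp_map_is_linear : linear mp_map.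
Proof.
move=> c u v; rewrite /mp_map scaler_sumr -big_split; apply: eq_bigr => j _ /=.
by rewrite mulmxDr -scalemxAr mxtraceD mxtraceZ scalerDl scalerA.
Qed.
HB.instance Definition _ := GRing.isLinear.Build R[i] _ _ _ mp_map mp_map_is_linear.
End MPMap.

(** * The coherent-state protocol and its overlaps *)

Section CoherentMeasurement.
Variable R : realType.
Local Notation C := R[i].
Variables (d m N q : nat) (d_gt0 : (0 < d)%N) (m_gt0 : (0 < m)%N).
Local Notation A := ('I_d * 'I_d)%type.
Variables (wt : 'I_q -> C) (z : 'I_q -> A -> C) (dz : is_design m wt z).
Variable B : 'I_N -> 'I_N -> {ffun 'I_m -> A} -> C.
Hypothesis Bs : forall i l, symmetric_fun (B i l).

Definition dilated (x : 'cV[C]_N) l w := \sum_i x i 0 * B i l w.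

Lemma dilated_sym x l : symmetric_fun (dilated x l).
Proof. by move=> s w; apply: eq_bigr => i _; rewrite Bs. Qed.

(** The vector representing the functional x |-> <z_y^m|v_l> with v_l = [dilated x l], whence the
    conjugation. *)
Definition coherent_vec y l : 'cV[C]_N := \col_j (amplitude z (B j l) y)^*.
(** The effects wt_y / m! |z_y^m><z_y^m|, which resolve the identity on symmetric vectors, pulled
    back along the dilation. *)
Definition coherent_povm y : 'M[C]_N :=
  (wt y / m`!%:R) *: \sum_l coherent_vec y l *m (coherent_vec y l)^t*.

Lemma coherent_povm_psd y : psdmx (coherent_povm y).
Proof.
apply: psdmxZ; first by rewrite divr_ge0 //; case: dz.
by apply: psdmx_sum => l; apply: psdmx_gram.
Qed.

Lemma amplitude_dilated x l y :
  amplitude z (dilated x l) y = \sum_i x i 0 * amplitude z (B i l) y.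
Proof.
rewrite /amplitude /dilated; under eq_bigr do rewrite mulr_sumr.
rewrite exchange_big; apply: eq_bigr => i _ /=; rewrite mulr_sumr.
by apply: eq_bigr => w _; ring.
Qed.

Lemma trace_coherent_povm x y : \tr (coherent_povm y *m ketbra x) =
  wt y / m`!%:R * \sum_l (amplitude z (dilated x l) y)^* * amplitude z (dilated x l) y.
Proof.
rewrite /coherent_povm -scalemxAl mxtraceZ; congr (_ * _).
rewrite mulmx_suml trace_sum; apply: eq_bigr => l _.
rewrite /ketbra mulmxA mxtrace_mulC !mulmxA -mulmxA.
have -> : x^t* *m coherent_vec y l = ((coherent_vec y l)^t* *m x)^t*.
  by rewrite trmxCM trmxCK.
rewrite /mxtrace big_ord1 mxE big_ord1 mxtrC.
have -> : ((coherent_vec y l)^t* *m x) 0 0 = amplitude z (dilated x l) y.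
  rewrite amplitude_dilated mxE; apply: eq_bigr => i _.
  by rewrite mxtrC mxE conjCK mulrC.
by [].
Qed.

Definition dilated_sqnorm x := \sum_l \sum_w (dilated x l w)^* * dilated x l w.

Lemma sum_trace_coherent_povm x :
  \sum_y \tr (coherent_povm y *m ketbra x) = dilated_sqnorm x.
Proof.
under eq_bigr do rewrite trace_coherent_povm mulr_sumr.
rewrite exchange_big; apply: eq_bigr => l _ /=.
have f0 : m`!%:R != 0 :> C by rewrite pnatr_eq0 -lt0n fact_gt0.
apply: (mulfI f0); rewrite -(sum_amplitude_sq dz (dilated_sym x l)) mulr_sumr.
by apply: eq_bigr => y _; field.
Qed.

Definition default_state : 'M[C]_(tdim d m) :=
  let i0 := enum_rank [ffun=> Ordinal d_gt0] in delta_mx i0 i0.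

Lemma default_stateP : is_state default_state.
Proof.
split; last first.
  rewrite /mxtrace (bigD1 (enum_rank [ffun=> Ordinal d_gt0])) //= mxE eqxx /=.
  by rewrite big1 ?addr0 // => i /negbTE i0; rewrite mxE i0.
rewrite /default_state; set i0 := enum_rank _.
have -> : delta_mx i0 i0 = (delta_mx i0 0 : 'cV[C]__) *m (delta_mx i0 0 : 'cV[C]__)^t*.
  rewrite trmx_delta map_delta_mx mul_delta_mx //.
exact: psdmx_gram.
Qed.

(** A node z_y = 0 cannot be normalised; as m > 0 its amplitude is zero, so the default state is
    prepared with probability zero. *)
Definition coherent_state y : 'M[C]_(tdim d m) :=
  if sqnorm (z y) == 0 then default_state
  else (sqnorm (z y) ^+ m)^-1 *: reduced (zpow (z y) (n := m)).

Lemma coherent_stateP y : is_state (coherent_state y).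
Proof.
rewrite /coherent_state; case: eqP => [_|/eqP N0]; first exact: default_stateP.
split.
  apply: psdmxZ; last exact: reduced_psd.
  by rewrite invr_ge0 exprn_ge0 ?sqnorm_ge0.
rewrite mxtraceZ reduced_trace; under eq_bigr do rewrite mulrC.
by rewrite zpow_norm mulVf // expf_neq0.
Qed.

Variables (k : nat) (hkm : (k <= m)%N) (k_gt0 : (0 < k)%N).

Lemma ket_overlap_coherent_state v y : sqnorm (z y) != 0 ->
  ket_overlap hkm v (coherent_state y) =
  form (ket_effect d k v) (zpow (z y) (n := k)) (zpow (z y) (n := k)) / sqnorm (z y) ^+ k.
Proof.
move=> N0; rewrite /coherent_state (negbTE N0).
have := ket_overlap_sum hkm v (fun _ : 'I_1 => (sqnorm (z y) ^+ m)^-1)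
  (fun=> reduced (zpow (z y) (n := m))).
rewrite !big_ord1 => ->; rewrite ket_overlap_reduced /local_form.
transitivity ((sqnorm (z y) ^+ m)^-1 * (sqnorm (z y) ^+ (m - k) *
   form (ket_effect d k v) (zpow (z y) (n := k)) (zpow (z y) (n := k)))).
  congr (_ * _); rewrite -zpow_norm mulr_suml; apply: eq_bigr => u _.
  rewrite /form mulr_sumr; apply: eq_bigr => s _.
  rewrite mulr_sumr; apply: eq_bigr => s' _.
  by rewrite !zpow_catw rmorphM /=; ring.
rewrite -{1}(subnK hkm) exprD; field.
by rewrite !expf_neq0.
Qed.

Lemma ket_overlap_mp_map v x :
  ket_overlap hkm v (mp_map coherent_povm coherent_state (ketbra x)) =
  (\sum_l mp_form (k := k) wt z (dilated x l) (ket_effect d k v)) / m`!%:R.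
Proof.
rewrite ket_overlap_sum mulr_suml.
under [RHS]eq_bigr do rewrite /mp_form mulr_suml.
rewrite [RHS]exchange_big; apply: eq_bigr => y _ /=.
rewrite trace_coherent_povm mulr_sumr mulr_suml; apply: eq_bigr => l _.
have [N0|N0] := eqVneq (sqnorm (z y)) 0.
  by rewrite (amplitude0 hkm k_gt0) // !(mulr0, mul0r).
by rewrite ket_overlap_coherent_state //; ring.
Qed.

Lemma mp_map_trace x :
  \tr (mp_map coherent_povm coherent_state (ketbra x)) = dilated_sqnorm x.
Proof.
rewrite -sum_trace_coherent_povm /mp_map trace_sum; apply: eq_bigr => y _.
by rewrite mxtraceZ; case: (coherent_stateP y) => _ ->; rewrite mulr1.
Qed.

Variable Phi : {linear 'M[C]_N -> 'M[C]_(tdim d m)}.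
Hypothesis PhiE : forall x, Phi (ketbra x) = \sum_l reduced (dilated x l).
Hypothesis Phi_tni : trace_nonincreasing Phi.

Lemma Phi_trace x : \tr (Phi (ketbra x)) = dilated_sqnorm x.
Proof. by rewrite PhiE trace_sum; apply: eq_bigr => l _; rewrite reduced_trace. Qed.

Lemma ketbra_psd (x : 'cV[C]_N) : psdmx (ketbra x).
Proof. exact: psdmx_gram. Qed.

Lemma coherent_pm_protocol : pm_protocol (mp_map coherent_povm coherent_state).
Proof.
apply: (pm_protocol_finite coherent_povm_psd _ coherent_stateP default_stateP) => //.
move=> x.
(* The total mass is at most 1 because the outcome probabilities add up to the trace of the output
   of [Phi], which does not exceed that of the input. *)
have -> : (x^t* *m (1%:M - \sum_j coherent_povm j) *m x) 0 0 =
    \tr (ketbra x) - \tr (Phi (ketbra x)).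
  rewrite Phi_trace -sum_trace_coherent_povm -trace_sum -mulmx_suml.
  rewrite -(raddfB (@mxtrace C N)) /= -{1}[ketbra x]mul1mx -mulmxBl.
  by rewrite /ketbra mulmxA mxtrace_mulC mulmxA /mxtrace big_ord1.
by rewrite subr_ge0; apply: Phi_tni; apply: ketbra_psd.
Qed.

(** The inequalities of [de_finetti_bounds] are linear in the forms and add up over l;
    [effect_bound] is then applied once to the sums, with D = #|A| = d^2. *)
Lemma coherent_overlap_bounds v x : unit_ket v ->
  let a := complex.Re (ket_overlap hkm v (Phi (ketbra x))) in
  let b := complex.Re (ket_overlap hkm v (mp_map coherent_povm coherent_state (ketbra x))) in
  let V := complex.Re (dilated_sqnorm x) in
  [/\ 0 <= a <= V, 0 <= b <= V & `|a - b| <= (2 * k * d ^ 2)%:R / m%:R * V].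
Proof.
move=> v1; pose g := ket_effect d k v.
pose a := \sum_l local_form hkm g (dilated x l).
pose M := \sum_l mp_form (k := k) wt z (dilated x l) g.
pose V := dilated_sqnorm x.
have eff := fun y => ket_effect_bounds y v1 : 0 <= form g y y <= _.
have bnd l := de_finetti_bounds hkm k_gt0 dz (dilated_sym x l) eff.
have -> : ket_overlap hkm v (Phi (ketbra x)) = a.
  rewrite PhiE; have := ket_overlap_sum hkm v (fun _ : 'I_N => 1) (fun l => reduced (dilated x l)).
  under eq_bigr do rewrite scale1r.
  by move=> ->; apply: eq_bigr => l _; rewrite mul1r ket_overlap_reduced.
rewrite ket_overlap_mp_map -/M -/V.
set f := (rising (m - k + #|{: A}|) k * (m - k)`!)%N in bnd.
have [a0 aV] : 0 <= a /\ a <= V.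
  by split; [apply: sumr_ge0|apply: ler_sum] => l _; case: (bnd l) => /andP[].
have [M0 MV] : 0 <= M /\ M <= m`!%:R * V.
  rewrite /V /dilated_sqnorm mulr_sumr.
  by split; [apply: sumr_ge0|apply: ler_sum] => l _; case: (bnd l) => _ /andP[].
have QE : f%:R * a - 2 * m`!%:R * a + M = \sum_l (f%:R * local_form hkm g (dilated x l)
    - 2 * m`!%:R * local_form hkm g (dilated x l) + mp_form (k := k) wt z (dilated x l) g).
  by rewrite big_split sumrB -!mulr_sumr.
have [Q0 QV] : 0 <= f%:R * a - 2 * m`!%:R * a + M /\
    f%:R * a - 2 * m`!%:R * a + M <= (f%:R - m`!%:R) * V.
  rewrite QE /V /dilated_sqnorm mulr_sumr.
  by split; [apply: sumr_ge0|apply: ler_sum] => l _; case: (bnd l) => _ _ /andP[].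
have V0 := le_trans a0 aV.
have natC (p : nat) : (p%:R : C) = ((p%:R : R)%:C)%C by rewrite rmorph_nat.
have -> : complex.Re (M / m`!%:R) = complex.Re M / m`!%:R.
  by rewrite {1}(ge0_Re M0) natC -(fmorphV (real_complex R)) -(rmorphM (real_complex R)).
(* All the sums are nonnegative, hence real, so the inequalities pass from [R[i]] to their real
   parts. *)
move: a0 aV M0 MV Q0 QV; rewrite (ge0_Re V0); have := V0 => /Re_ge0.
move=> V0' a0; rewrite (ge0_Re a0) => aV M0; rewrite (ge0_Re M0).
set a' := complex.Re a in aV *; set M' := complex.Re M; set V' := complex.Re V in aV V0' *.
rewrite !natC -!(rmorphM (real_complex R)) -!(rmorphN (real_complex R)).
rewrite -!(rmorphD (real_complex R)) -!(rmorphM (real_complex R)) !lecR /=.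
have aE : a = (a'%:C)%C by apply: ge0_Re.
have := Re_ge0 a0; have := Re_ge0 M0; rewrite -/a' -/M' => M0' a0'.
move: aV; rewrite lecR => aV MV Q0 QV.
have H : `|a' - M' / m`!%:R| <= (2 * k * #|{: A}|)%:R / m%:R * V'.
  apply: effect_bound => //; rewrite -?/f ?a0' ?M0' ?Q0 //.
  by rewrite card_prod card_ord muln_gt0 d_gt0.
rewrite card_prod card_ord mulnn in H.
split; [by rewrite a0'| |by []].
  by rewrite divr_ge0 // ler_pdivrMr ?ltr0n ?fact_gt0 // mulrC.
Qed.
End CoherentMeasurement.

Theorem mainTheorem6 (R : realType) (d n k m : nat)
    (X : choiceType) (psi : X -> 'cV[R[i]]_d)
    (C : {linear 'M[R[i]]_(tdim d n) -> 'M[R[i]]_(tdim d m)})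
    (d_gt0 : (0 < d)%N) (n_gt0 : (0 < n)%N) (k_gt0 : (0 < k)%N)
    (k_le_m : (k <= m)%N)
    (psi_unit : forall x, unit_ket (psi x))
    (C_op : quantum_operation C)
    (C_inv : perm_invariant_output C) :
  exists Ct : {linear 'M[R[i]]_(tdim d n) -> 'M[R[i]]_(tdim d m)},
    [/\ pm_protocol Ct,
        forall x, \tr (Ct (input_state n (psi x))) =
                  \tr (C (input_state n (psi x))),
        forall x, 0 < succ_prob C (psi x) ->
          `|fidelity k_le_m C (psi x) - fidelity k_le_m Ct (psi x)|
            <= (2 * k * d ^ 2)%:R / (m%:R * succ_prob C (psi x))
      & forall p : X -> R, is_prior p -> 0 < avg_succ_prob C psi p ->
          `|avg_fidelity k_le_m C psi p - avg_fidelity k_le_m Ct psi p|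
            <= (2 * k * d ^ 2)%:R / (m%:R * avg_succ_prob C psi p)].
Proof.
have m_gt0 := leq_trans k_gt0 k_le_m.
have [q [wt [z dz]]] := design_exists_ord R[i] ('I_d * 'I_d)%type m.
have [C_cp C_tni] := C_op.
have [B [Bs CE]] := symmetric_dilation C_cp C_inv.
pose Ct : {linear 'M[R[i]]_(tdim d n) -> 'M[R[i]]_(tdim d m)} :=
  mp_map (coherent_povm wt z B) (coherent_state m d_gt0 z).
exists Ct.
have trE x : \tr (Ct (input_state n (psi x))) = \tr (C (input_state n (psi x))).
  by rewrite input_state_ketbra (mp_map_trace d_gt0 dz Bs) (Phi_trace CE).
have succE x : succ_prob Ct (psi x) = succ_prob C (psi x) by rewrite /succ_prob trE.
(* The overlap bound carries the factor V = [succ_prob C (psi x)]; bounding it by 1 makes the bound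
   uniform in x, as averaging requires. *)
have succ1 x : succ_prob C (psi x) <= 1.
  have in_psd : psdmx (input_state n (psi x)) by rewrite input_state_ketbra; exact: ketbra_psd.
  have tr1 : \tr (input_state n (psi x)) = 1.
    rewrite input_state_ketbra /ketbra mxtrace_mulC /mxtrace big_ord1 mxE.
    under eq_bigr do rewrite mxtrC tens_ketE mulrC.
    rewrite -(sum_word (fun h => zpow ((psi x)^~ 0) h * (zpow ((psi x)^~ 0) h)^*)).
    by rewrite zpow_norm unit_ket_sqnorm // expr1n.
  by have := C_tni _ in_psd; rewrite tr1 lecE => /andP[].
pose c : R := (2 * k * d ^ 2)%:R / m%:R.
have c0 : 0 <= c by rewrite divr_ge0.
have bnd x : [/\ 0 <= overlap k_le_m C (psi x) <= 1, 0 <= overlap k_le_m Ct (psi x) <= 1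
    & `|overlap k_le_m C (psi x) - overlap k_le_m Ct (psi x)| <= c].
  have [] := coherent_overlap_bounds d_gt0 dz Bs k_le_m k_gt0 CE (tens_ket (fun=> psi x)) (psi_unit x).
  rewrite -(Phi_trace CE) -input_state_ketbra -/(succ_prob C (psi x)).
  move=> /andP[a0 a1] /andP[b0 b1] ab; split.
  - by rewrite a0 (le_trans a1).
  - by rewrite b0 (le_trans b1).
  - by apply: le_trans ab _; rewrite ler_piMr.
split=> //.
- exact: coherent_pm_protocol CE C_tni.
(* Equal success probabilities give both fidelities the same denominator, so only the overlaps are
   compared; the averages are treated likewise. *)
- move=> x s0; rewrite /fidelity succE -mulrBl normrM normfV (gtr0_norm s0).
  rewrite invfM mulrA ler_wpM2r ?invr_ge0 ?(ltW s0) //.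
  by case: (bnd x).
- move=> p pp s0; have sE : avg_succ_prob Ct psi p = avg_succ_prob C psi p.
    by rewrite /avg_succ_prob; congr average; apply/funext => x.
  rewrite /avg_fidelity sE -mulrBl normrM normfV (gtr0_norm s0).
  rewrite invfM mulrA ler_wpM2r ?invr_ge0 ?(ltW s0) //.
  by apply: average_dist => // x; case: (bnd x).
Qed.
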